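(* For any integer $r\geq 2$, there are constants $\alpha>0$, $\beta$, and $n_0$ such that for any graph $G$ with $n$ vertices, if $\delta(G)\geq \left(\frac12-\alpha\right)n+\beta$ and $n\geq n_0$, then $$\chi(\mathrm{KG}(G,rK_2))=\zeta(\mathrm{KG}(G,rK_2))=|E(G)|-\mathrm{ex}(G,rK_2).$$
   Context: All graphs and hypergraphs are finite and simple; $\delta(G)$ is the minimum degree and $\chi$ the chromatic number (equal to $0$ for the graph with no vertices). $rK_2$ is a matching of size $r$. Matching graph and Turán number: $\mathrm{KG}(G,rK_2)$ is the graph whose vertices are all matchings of size $r$ in $G$ (subgraphs isomorphic to $rK_2$), two being adjacent if they are edge-disjoint. $\mathrm{ex}(G,rK_2)$ is the maximum number of edges of a spanning subgraph of $G$ containing no subgraph isomorphic to $rK_2$. Altermatic number: for $X\in\{-1,0,+1\}^N$, $alt(X)$ is the length of a longest subsequence of nonzero terms of $X$ in which any two consecutive terms are different ($alt(0)=0$). For a hypergraph $\mathcal{H}$ (hyperedges are nonempty sets) with $|V(\mathcal{H})|=N$ and a linear ordering $\sigma=(\sigma(1),\ldots,\sigma(N))$ of $V(\mathcal{H})$, put $X^+_\sigma=\{\sigma(j): x_j=+1\}$ and $X^-_\sigma=\{\sigma(j): x_j=-1\}$. $alt_\sigma(\mathcal{H})$ is the largest $k$ for which there is an $X\in\{-1,0,+1\}^N$ with $alt(X)=k$ such that neither $X^+_\sigma$ nor $X^-_\sigma$ contains a hyperedge of $\mathcal{H}$; $alt(\mathcal{H})=\min_\sigma alt_\sigma(\mathcal{H})$.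 $\mathrm{KG}(\mathcal{H})$ is the graph whose vertices are the hyperedges of $\mathcal{H}$, two being adjacent if they are disjoint. The altermatic number of a graph $F$ is $\zeta(F)=\max_{\mathcal{H}}\{|V(\mathcal{H})|-alt(\mathcal{H})\}$, over all hypergraphs $\mathcal{H}$ such that $\mathrm{KG}(\mathcal{H})$ and $F$ are homomorphically equivalent (there are graph homomorphisms in both directions). *)

(* Defs.v *)
From mathcomp Require Import all_boot.

Set Implicit Arguments.
Unset Strict Implicit.
Unset Printing Implicit Defensive.

Record sgraph := SGraph {
  vert :> finType;
  adj : rel vert;
  adj_sym : symmetric adj;
  adj_irr : irreflexive adj
}.

Definition degree (G : sgraph) (x : G) : nat := #|[set y | adj x y]|.

(* Degrees are smaller than #|G|, so for a graph with at least one vertex this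
   is the true minimum; it is 0 for the graph without vertices. *)
Definition min_degree (G : sgraph) : nat := \big[minn/#|G|]_(x : G) degree x.

Definition edges (G : sgraph) : {set {set G}} :=
  [set e | [exists x : G, exists y : G, adj x y && (e == [set x; y])]].

Definition colorable (G : sgraph) (k : nat) : bool :=
  [exists c : {ffun G -> 'I_k}, forall x, forall y, adj x y ==> (c x != c y)].

Lemma colorable_ex (G : sgraph) : exists k, colorable G k.
Proof.
exists #|G|; apply/existsP; exists [ffun x => enum_rank x].
apply/forallP=> x; apply/forallP=> y; apply/implyP=> xy.
rewrite !ffunE (inj_eq enum_rank_inj).
by apply: contraTneq xy => ->; rewrite adj_irr.
Qed.

Definition chi (G : sgraph) : nat := ex_minn (colorable_ex G).

Definition hom (F G : sgraph) : Prop :=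
  exists f : F -> G, forall x y, adj x y -> adj (f x) (f y).

Definition hom_equiv (F G : sgraph) : Prop := hom F G /\ hom G F.

Section Kneser.
Variables (T : finType) (S : {set {set T}}).

Definition kneser_adj : rel {A : {set T} | A \in S} :=
  fun A B => (A != B) && [disjoint val A & val B].

Fact kneser_sym : symmetric kneser_adj.
Proof. by move=> A B; rewrite /kneser_adj eq_sym disjoint_sym. Qed.

Fact kneser_irr : irreflexive kneser_adj.
Proof. by move=> A; rewrite /kneser_adj eqxx. Qed.

Definition kneser : sgraph := SGraph kneser_sym kneser_irr.
End Kneser.

Definition matchings (T : finType) (E : {set {set T}}) (r : nat) :
    {set {set {set T}}} :=
  [set M : {set {set T}} | [&& M \subset E, #|M| == r & trivIset M]].

(* KG(G, rK_2): disjointness is taken in {set {set G}}, so it means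
   edge-disjointness. *)
Definition KG_matching (G : sgraph) (r : nat) : sgraph :=
  kneser (matchings (edges G) r).

(* ex(G, rK_2): a spanning subgraph of G is given by its edge set. *)
Definition ex_matching (G : sgraph) (r : nat) : nat :=
  \max_(S : {set {set G}} | (S \subset edges G) && (matchings S r == set0)) #|S|.

Record hypergraph := Hypergraph {
  hvert : finType;
  hedges : {set {set hvert}};
  hedges_neq0 : set0 \notin hedges
}.

Definition KG (H : hypergraph) : sgraph := kneser (hedges H).

(* Signs {-1, 0, +1}: None is 0, Some true is +1 and Some false is -1. *)
Definition sign := option bool.

(* [m] selects the positions of a subsequence of [X]. *)
Definition alt_seq (X : seq sign) : nat :=
  \max_(m : (size X).-tuple bool
        | all isSome (mask m X) && sorted (fun x y => x != y) (mask m X))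
    size (mask m X).

Section Alternation.
Variable H : hypergraph.
Notation N := #|hvert H|.

(* The positions of [X] labelled [b], as vertices in the ordering [sigma]. *)
Definition sign_part (sigma : N.-tuple (hvert H)) (X : N.-tuple sign)
    (b : bool) : {set hvert H} :=
  [set tnth sigma j | j : 'I_N & tnth X j == Some b].

Definition contains_hedge (A : {set hvert H}) : bool :=
  [exists B in hedges H, B \subset A].

Definition alt_ord (sigma : N.-tuple (hvert H)) : nat :=
  \max_(X : N.-tuple sign | ~~ contains_hedge (sign_part sigma X true)
                         && ~~ contains_hedge (sign_part sigma X false))
    alt_seq X.

(* Linear orderings are the duplicate-free N-tuples of vertices.  Each
   [alt_ord sigma] is at most N, so the default value N does not affect the
   minimum. *)
Definition alt : nat :=
  \big[minn/N]_(sigma : N.-tuple (hvert H) | uniq sigma) alt_ord sigma.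
End Alternation.

(* [is_altermatic F z] says that zeta(F) = z, i.e. z is the maximum of
   |V(H)| - alt(H) over all H with KG(H) homomorphically equivalent to F.
   The class of such H is infinite, so that the maximum exists is part of the
   assertion.  The subtraction is never truncated, as alt(H) <= |V(H)|. *)
Definition is_altermatic (F : sgraph) (z : nat) : Prop :=
  (exists2 H : hypergraph, hom_equiv (KG H) F & #|hvert H| - alt H = z) /\
  (forall H : hypergraph, hom_equiv (KG H) F -> #|hvert H| - alt H <= z).

(* Main.v *)
Require Import Defs.
From mathcomp Require Import all_boot all_order all_algebra.
From mathcomp Require Import reals.
From mathcomp Require Import zify lra.
Set Implicit Arguments.
Unset Strict Implicit.
Unset Printing Implicit Defensive.

(** Let [E] be the edge set of [G] and [ex] the generalized Turan number.  Colouring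
    each [r]-matching by one of its edges outside a fixed extremal edge set gives
    [chi <= |E| - ex] ([chi_KG_matching_le]).  Tucker's lemma ([tucker]) gives
    [|V(H)| - alt(H) <= chi(KG(H))] for every hypergraph [H]
    ([altermatic_le_chi]), and [chi] is monotone under homomorphisms.  It remains
    to order [E] in such a way that every signing of [E] with more than [ex]
    alternations has an [r]-matching in one of its two sign classes
    ([edge_order]); then all three numbers agree.

    If a sign class has no [r]-matching, then fewer than [r] vertices have high
    degree in it, and up to boundedly many exceptions its edges meet this set of
    heavy vertices; there is no exception if the set has [r - 1] elements.  Call
    the two sets [S+] and [S-].  The edges meeting a set of fewer than [r]
    vertices contain no [r]-matching, so they number at most [ex].  Hence, up to
    a constant, the degree sum over [S+] plus the degree sum over [S-] is at most
    [2 * ex], and it suffices to bound twice the number of alternations by this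
    sum.  A vertex in both sets pays for each of its edges and may cost one
    alternation per edge.  A vertex in one set only may cost one alternation per
    two edges, so its edges have to come in consecutive pairs on average.  This is
    achieved by listing the out-stars of an orientation in which no in-degree
    exceeds the out-degree by more than one ([balanced_orientation],
    [stars_cost]): the out-edges of a vertex form essentially one run.

    This loses a constant, which is harmless when [S+] or [S-] has fewer than
    [r - 1] elements, because the minimum degree is large, and does not occur when
    [S+ = S-].  In the remaining case the constant is regained from gadgets placed
    before the out-stars: edge-disjoint copies of [K_{2,4}], many for each centre
    [u], listed along a closed trail such that the four edges at [u] form a single
    run unless another vertex of the gadget lies in [S+] or [S-]
    ([gadget_cost]).  Such gadgets exist as soon as the minimum degree is a fixed
    proportion of the number of vertices ([gadget_system]); the proportion [1 / 4]
    is used below. *)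

(** * Alternation as a number of runs *)

(** Greedy computation of the alternation number: every nonzero term that
    differs from the previous nonzero term [p] starts a new run. *)
Fixpoint runs (p : sign) (s : seq sign) : nat :=
  match s with
  | [::] => 0
  | None :: s' => runs p s'
  | Some b :: s' => (p != Some b) + runs (Some b) s'
  end.

Lemma runs_switch (p q : sign) (s : seq sign) : q != None ->
  runs p s <= (p != q) + runs q s.
Proof.
elim: s p q => [|[b|] s IHs] p q qN //=; last exact: IHs.
by case: (p =P q) => [->|] //=; case: (p != Some b); case: (q != Some b); lia.
Qed.

Lemma runs_le_None (p : sign) (s : seq sign) : runs p s <= runs None s.
Proof. by elim: s p => [|[b|] s IHs] p //=; case: (p != Some b); lia. Qed.

Lemma runs_None_le (p : sign) (s : seq sign) : runs None s <= (runs p s).+1.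
Proof. by elim: s p => [|[b|] s IHs] p //=; case: (p != Some b); lia. Qed.

Lemma runs_le_count (p : sign) (s : seq sign) : runs p s <= count isSome s.
Proof. by elim: s p => [|[b|] s IHs] p //=; have := IHs (Some b); case: (p != Some b); lia. Qed.

Lemma runs_cat (s t : seq sign) : runs None (s ++ t) <= runs None s + runs None t.
Proof.
suff H p : runs p (s ++ t) <= runs p s + runs None t by exact: H.
elim: s p => [|[b|] s IHs] p //=; first exact: runs_le_None.
by rewrite -addnA leq_add2l.
Qed.

Lemma runs_flatten (ss : seq (seq sign)) :
  runs None (flatten ss) <= \sum_(s <- ss) runs None s.
Proof.
elim: ss => [|s ss IHss] /=; first by rewrite big_nil.
by rewrite big_cons; apply: leq_trans (runs_cat _ _) _; rewrite leq_add2l.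
Qed.

Lemma runs_minority (b : bool) (s : seq sign) :
  runs None s <= 1 + (count (pred1 (Some (~~ b))) s).*2.
Proof.
suff H p : runs p s <= (p != Some b) + (count (pred1 (Some (~~ b))) s).*2.
  exact: H None.
elim: s p => [|[c|] s IHs] p //=.
have := IHs (Some c); rewrite !(inj_eq (@Some_inj _)).
by case: p => [p|]; rewrite ?(inj_eq (@Some_inj _)); case: b {IHs}; case: c; try case: p; 
  rewrite /=; lia.
Qed.

(** Erasing one term can merge two runs and so cost two alternations; this is
    the price of every exceptional edge below. *)
Lemma runs_erase (I : eqType) (x y : I -> sign) (l : seq I) :
  (forall i, y i != x i -> y i = None) ->
  runs None [seq x i | i <- l] <=
  runs None [seq y i | i <- l] + (count (fun i => y i != x i) l).*2.
Proof.
move=> yx; move: None => p; elim: l p => [|i l IHl] p //=.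
case: (eqVneq (y i) (x i)) => [->|/yx ->] /=.
  by case: (x i) => [b|] //=; rewrite -addnA leq_add2l.
case: (x i) => [b|] /=; last by have := IHl p; lia.
have := IHl (Some b).
have := @runs_switch (Some b) p [seq y i | i <- l].
have := runs_le_None (Some b) [seq y i | i <- l].
have := runs_None_le p [seq y i | i <- l].
by case: (p != Some b); lia.
Qed.

Lemma runs_mono (I : eqType) (x y : I -> sign) (l : seq I) (p : sign) :
  (forall i, x i != None -> y i = x i) ->
  runs p [seq x i | i <- l] <= runs p [seq y i | i <- l].
Proof.
move=> xy; elim: l p => [|i l IHl] p //=; case Dx: (x i) (xy i) => [b|] /=.
  by move=> -> //=; rewrite leq_add2l; exact: IHl.
move=> _; case: (y i) => [b|] //; apply: leq_trans (@runs_switch p (Some b) _ _) _ => //.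
by rewrite leq_add2l; exact: IHl.
Qed.

Lemma runs_opp (p : sign) (s : seq sign) :
  runs (omap negb p) (map (omap negb) s) = runs p s.
Proof.
elim: s p => [|[b|] s IHs] p //=; rewrite -(IHs (Some b)) /=; congr (_ + _).
by case: p => [p|] //; rewrite !(inj_eq (@Some_inj _)) (inj_eq negb_inj).
Qed.

(** A longest alternating subsequence takes exactly one term of each run. *)
Lemma alt_seqE (X : seq sign) : alt_seq X = runs None X.
Proof.
apply/eqP; rewrite eqn_leq; apply/andP; split.
  apply/bigmax_leqP => m /andP[mS mA].
  have: path (fun x y => x != y) None (mask m X).
    by case: (mask m X) mS mA => //= -[].
  move: mS {mA}; move: (m : seq bool) => {}m; move: None => p.
  elim: X m p => [|s X IHX] [|[] m] p //=.
    by case: s => [b|] //= mS /andP[-> mA]; rewrite add1n ltnS; exact: IHX.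
  move=> mS mA; apply: leq_trans (IHX _ _ mS mA) _.
  by case: s => [b|] //; exact: runs_switch.
have [m [sm mS mA Em]]: exists m, [/\ size m = size X, all isSome (mask m X),
    path (fun x y => x != y) None (mask m X) & size (mask m X) = runs None X].
  move: None => p; elim: X p => [|[b|] X IHX] p; first by exists [::].
    case: (eqVneq p (Some b)) => [->|pb].
      have [m [sm mS mA Em]] := IHX (Some b).
      by exists (false :: m); rewrite /= eqxx /= sm.
    have [m [sm mS mA Em]] := IHX (Some b).
    by exists (true :: m); rewrite /= pb sm mS mA Em.
  have [m [sm mS mA Em]] := IHX p.
  by exists (false :: m); rewrite /= sm.
rewrite -Em /alt_seq; move/eqP in sm.
apply: (@leq_bigmax_cond _ _ (fun m : (size X).-tuple bool => size (mask m X)) (Tuple sm)).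
by rewrite /= mS /=; case: (mask m X) mA => //= a l /andP[].
Qed.

(** * Tucker's lemma on the octahedral sphere *)

Notation "\xor_ ( x <- s ) F" := (\big[addb/false]_(x <- s) F)
  (at level 36, x, s at level 50, F at level 36).

(** Chains modulo 2 are lists of simplices, evaluated against boolean cochains
    by [\xor_]; a simplex is the list of its vertices.  The boundary of a chain
    is only ever used through its pairing with an arbitrary cochain. *)
Fixpoint faces (T : Type) (s : seq T) : seq (seq T) :=
  if s is a :: s' then s' :: map (cons a) (faces s') else [::].

(** The prism operator between the identity and the vertex map [e]: it consists
    of the simplices [X_1 .. X_j (e X_j) .. (e X_k)]. *)
Fixpoint prism (T : Type) (e : T -> T) (s : seq T) : seq (seq T) :=
  if s is a :: s' then (a :: e a :: map e s') :: map (cons a) (prism e s')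
  else [::].

Lemma faces_map (T U : Type) (f : T -> U) (s : seq T) :
  faces (map f s) = map (map f) (faces s).
Proof. by elim: s => //= a s ->; rewrite -!map_comp. Qed.

Lemma faces_subseq (T : eqType) (s y : seq T) : y \in faces s -> subseq y s.
Proof.
elim: s y => //= a s IHs y; rewrite inE => /predU1P[->|/mapP[z /IHs zs ->]].
  exact: subseq_cons.
by rewrite eqxx.
Qed.

(** The prism is a chain homotopy from the identity to [e]. *)
Lemma faces_prism (T : eqType) (e : T -> T) (g : seq T -> bool) (s : seq T) :
  \xor_(z <- prism e s) \xor_(y <- faces z) g y =
  (\xor_(y <- faces s) \xor_(z <- prism e y) g z) (+) (g s (+) g (map e s)).
Proof.
elim: s g => [|a s IHs] g /=; first by rewrite !big_nil /= addbb.
have E (x : T) (F : seq T -> seq (seq T)) (l : seq (seq T)) y :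
    \xor_(z <- l) \xor_(t <- y z :: map (cons x) (F z)) g t =
    (\xor_(z <- l) g (y z)) (+) \xor_(z <- l) \xor_(t <- F z) g (x :: t).
  by rewrite -big_split; apply: eq_bigr => z _; rewrite big_cons big_map.
rewrite big_cons big_map /= (E a (@faces T)) !big_cons !big_map faces_map big_map.
rewrite /= (E a (prism e)) (IHs (fun y => g (a :: y))).
move: (\xor_(z <- prism e s) g z) => A.
move: (\xor_(y <- faces s) \xor_(z <- prism e y) g (a :: z)) => B.
move: (\xor_(y <- faces s) g [:: a, e a & map e y]) => C.
by case: A; case: B; case: C; case: (g _); case: (g _); case: (g _).
Qed.

Fixpoint alternates (b : bool) (s : seq bool) : bool :=
  if s is c :: s' then (c == b) && alternates (~~ b) s' else true.

(** Fan's counting identity.  A nonempty word alternating from either sign has exactly one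
    face alternating from [b], obtained by dropping the first or the last letter;
    any other word has zero or two such faces. *)
Lemma faces_alternates (b : bool) (s : seq bool) :
  \xor_(y <- faces s) alternates b y = alternates b s (+) alternates (~~ b) s.
Proof.
elim: s b => [|c s IHs] b /=; first by rewrite big_nil.
rewrite big_cons big_map /= negbK.
have ->: \xor_(y <- faces s) ((c == b) && alternates (~~ b) y) =
   (c == b) && \xor_(y <- faces s) alternates (~~ b) y.
  by rewrite -big_distrr.
rewrite IHs negbK; case: b; case: c; rewrite /= ?addbF ?addbA ?addbb;
  by move: (alternates true s) (alternates false s) => [] [].
Qed.

Lemma perm_faces (T : eqType) (F : seq T -> bool) (s t : seq T) :
  (forall u v, perm_eq u v -> F u = F v) -> perm_eq s t ->
  \xor_(y <- faces s) F y = \xor_(y <- faces t) F y.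
Proof.
have facesE (l : seq T) (F' : seq T -> bool) : 
  (forall u v, perm_eq u v -> F' u = F' v) ->
  \xor_(y <- faces l) F' y = \xor_(a <- l) F' (rem a l).
  elim: l F' => [|b l IHl] F' F'P /=; first by rewrite !big_nil.
  rewrite !big_cons eqxx big_map IHl; last first.
    by move=> u v uv; apply: F'P; rewrite perm_cons.
  congr (_ (+) _); apply: eq_big_seq => a al.
  case: eqP => [->|//]; apply: F'P; rewrite perm_sym; exact: perm_to_rem al.
move=> FP st; rewrite !facesE // (perm_big _ st) /=.
apply: eq_big_seq => a at_; have as_: a \in s by rewrite (perm_mem st).
apply: FP; rewrite -(perm_cons a) (permPl (_ : perm_eq _ s)).
  by rewrite (permPl st); exact: perm_to_rem.
by rewrite perm_sym; exact: perm_to_rem.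
Qed.

(** * Signed labels *)

(** The signed label with absolute value [h + 1] is encoded as [2h] or [2h + 1],
    the parity being the sign; [opp] flips the parity. *)
Definition opp (k : nat) : nat := if odd k then k.-1 else k.+1.

Lemma oppK : involutive opp.
Proof.
move=> k; rewrite /opp; case k0: (odd k) => /=; last by rewrite k0.
by case: k k0 => //= k /negbTE ->.
Qed.

Lemma odd_opp (k : nat) : odd (opp k) = ~~ odd k.
Proof.
rewrite /opp; case k0: (odd k) => /=; last by rewrite k0.
by case: k k0 => //= k /negbTE ->.
Qed.

(** Sorting the codes sorts the labels by absolute value; labels with the same
    absolute value have the same sign as soon as no two are opposite. *)
Definition alternating (b : bool) (l : seq nat) : bool :=
  alternates b [seq odd k | k <- sort leq l].

Lemma perm_alternating (b : bool) (l l' : seq nat) :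
  perm_eq l l' -> alternating b l = alternating b l'.
Proof.
move=> ll'; rewrite /alternating; congr (alternates b (map odd _)).
exact/(perm_sortP leq_total leq_trans anti_leq).
Qed.

Lemma faces_alternating (b : bool) (l : seq nat) :
  \xor_(y <- faces l) alternating b y = alternating b l (+) alternating (~~ b) l.
Proof.
rewrite (perm_faces (@perm_alternating b) (t := sort leq l)); last first.
  by rewrite perm_sym perm_sort.
rewrite /alternating -faces_alternates faces_map big_map.
apply: eq_big_seq => y /faces_subseq ys; rewrite sorted_sort //.
  exact: leq_trans.
exact: (subseq_sorted leq_trans ys (sort_sorted leq_total l)).
Qed.

Definition consistent (l : seq nat) : Prop :=
  forall k k', k \in l -> k' \in l -> k' != opp k.

Lemma alternating_opp (b : bool) (l : seq nat) : consistent l ->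
  alternating b (map opp l) = alternating (~~ b) l.
Proof.
move=> lC; have cS: {in sort leq l &, forall k k', k' != opp k}.
  by move=> k k'; rewrite !mem_sort; exact: lC.
have E: sort leq (map opp l) = map opp (sort leq l).
  apply: (sorted_eq leq_trans anti_leq); first exact: sort_sorted leq_total _.
    have := sort_sorted leq_total l; case: (sort leq l) cS => //= k s.
    elim: s k => //= k' s IHs k cS /andP[kk' ks]; apply/andP; split.
      have /= := cS k k'; rewrite !inE !eqxx orbT => /(_ isT isT).
      by rewrite /opp; do 2!case: ifP; lia.
    apply: IHs => // x y xs ys; apply: cS; rewrite inE ?xs ?ys orbT //.
  by rewrite perm_sort perm_map // perm_sym perm_sort.
rewrite /alternating E; elim: (sort leq l) b => //= k s IHs b.
by rewrite IHs odd_opp; case: (odd k); case: b.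
Qed.

(** Neighbours in the sorted list have different signs and are not opposite, so
    the absolute values increase strictly. *)
Lemma alternating_size (b : bool) (l : seq nat) (m : nat) :
  consistent l -> alternating b l -> {in l, forall k, k./2 < m} -> size l <= m.
Proof.
move=> lC; rewrite /alternating.
have cS: {in sort leq l &, forall k k', k' != opp k}.
  by move=> k k'; rewrite !mem_sort; exact: lC.
move=> lA lm; rewrite -(size_sort leq) -(size_map half) -(size_iota 0 m).
apply: uniq_leq_size; last first.
  by move=> h /mapP[k + ->]; rewrite mem_sort => /lm km; rewrite mem_iota.
apply: (sorted_uniq ltn_trans ltnn).
have := sort_sorted leq_total l; case: (sort leq l) lA cS => //= k s /andP[/eqP kb].
elim: s k b kb => //= k' s IHs k b kb /andP[/eqP kb' sA] cS /andP[kk' ks].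
apply/andP; split.
  have := cS k k'; rewrite !inE !eqxx orbT => /(_ isT isT).
  have := odd_double_half k; have := odd_double_half k'.
  by rewrite kb kb' /opp kb; case: (b) => /=; lia.
apply: (IHs k' (~~ b)) => // x y xs ys; apply: cS; rewrite inE ?xs ?ys orbT //.
Qed.

(** * Chains of sign vectors *)

Section Tucker.
Variable N : nat.
Implicit Types X Y : N.-tuple sign.

Definition antipode X : N.-tuple sign := [tuple of map (omap negb) X].

Definition raise (i : 'I_N) X : N.-tuple sign :=
  [tuple if j == i then Some true else tnth X j | j < N].

Definition below X Y : bool :=
  [forall i, (tnth X i != None) ==> (tnth Y i == tnth X i)].

Definition nonzero X : bool := [exists i, tnth X i != None].

Definition supported (k : nat) X : bool :=
  [forall i : 'I_N, (k <= i) ==> (tnth X i == None)].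

Lemma belowP X Y :
  reflect (forall i, tnth X i != None -> tnth Y i = tnth X i) (below X Y).
Proof.
apply: (iffP forallP) => H i; first by move=> Xi; apply/eqP/(implyP (H i)).
by apply/implyP=> /H ->.
Qed.

Lemma below_refl : reflexive below.
Proof. by move=> X; apply/belowP. Qed.

Lemma below_trans : transitive below.
Proof.
move=> Y X Z /belowP XY /belowP YZ; apply/belowP => i Xi.
by rewrite YZ XY.
Qed.

Lemma antipodeK : involutive antipode.
Proof.
by move=> X; apply: eq_from_tnth => i; rewrite !tnth_map; case: (tnth X i) => [[]|].
Qed.

Lemma antipode_None X i : (tnth (antipode X) i == None) = (tnth X i == None).
Proof. by rewrite tnth_map; case: (tnth X i). Qed.

Lemma nonzero_antipode X : nonzero (antipode X) = nonzero X.
Proof. by apply: eq_existsb => i; rewrite antipode_None. Qed.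

Lemma supported_antipode k X : supported k (antipode X) = supported k X.
Proof. by apply: eq_forallb => i; rewrite antipode_None. Qed.

Lemma below_antipode X Y : below (antipode X) (antipode Y) = below X Y.
Proof.
apply: eq_forallb => i; rewrite antipode_None; case: eqP => //= _.
by rewrite !tnth_map; case: (tnth X i); case: (tnth Y i) => // -[] [].
Qed.

Lemma nonzero_raise i X : nonzero (raise i X).
Proof. by apply/existsP; exists i; rewrite tnth_mktuple eqxx. Qed.

Lemma below_raise (i : 'I_N) X : supported i X -> below X (raise i X).
Proof.
move=> /forallP/(_ i); rewrite leqnn => /eqP Xi; apply/belowP => j Xj.
by rewrite tnth_mktuple; case: (j =P i) => // ji; rewrite ji Xi eqxx in Xj.
Qed.

Lemma raise_mono i X Y : below X Y -> below (raise i X) (raise i Y).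
Proof.
by move/belowP=> XY; apply/belowP=> j; rewrite !tnth_mktuple; case: (j =P i) => // _; exact: XY.
Qed.

Lemma supportedW k X : supported k X -> supported k.+1 X.
Proof.
move/forallP=> H; apply/forallP=> i; apply/implyP=> ki.
exact: (implyP (H i) (ltnW ki)).
Qed.

Lemma supported_raise (i : 'I_N) X : supported i X -> supported i.+1 (raise i X).
Proof.
move/forallP=> H; apply/forallP=> j; apply/implyP=> ij.
rewrite tnth_mktuple; case: (j =P i) => [ji|_]; first by rewrite ji ltnn in ij.
exact: (implyP (H j) (ltnW ij)).
Qed.

(** The prism maps chains of the order [below] to chains: [X <= e X] and [e] is
    monotone, so the lifted tail of a chain lies above its untouched head. *)
Lemma mem_prism (e : N.-tuple sign -> N.-tuple sign) (x z : seq (N.-tuple sign)) :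
    (forall X, X \in x -> below X (e X)) ->
    (forall X Y, below X Y -> below (e X) (e Y)) ->
    pairwise below x -> z \in prism e x ->
  [/\ size z = (size x).+1, pairwise below z & {subset z <= x ++ map e x}].
Proof.
move=> xe emono; elim: x z xe => //= X x IHx z xe /andP[Xx xx].
have XeX : below X (e X) by apply: xe; rewrite mem_head.
rewrite inE => /predU1P[->|/mapP[y yx ->]].
  split; first by rewrite /= size_map.
    rewrite /= XeX /= all_map; apply/and3P; split.
    - by apply/allP=> Y Yx /=; apply: below_trans XeX (emono _ _ (allP Xx _ Yx)).
    - by rewrite all_map; apply/allP=> Y Yx /=; apply: emono (allP Xx _ Yx).
    - by rewrite pairwise_map; apply: sub_pairwise xx => Y Z /emono.
  move=> Y; rewrite !inE mem_cat inE => /or3P[->|->|->]; rewrite ?orbT //.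
have {}IHx := IHx y _ xx yx; have [Y Yx|sy yy ysub] := IHx _.
  by apply: xe; rewrite inE Yx orbT.
split; first by rewrite /= sy.
  rewrite /= yy andbT; apply/allP => Y /ysub; rewrite mem_cat => /orP[/(allP Xx)//|].
  by case/mapP=> Z /(allP Xx) XZ ->; apply: below_trans XeX (emono _ _ XZ).
move=> Y; rewrite !(inE, mem_cat) => /predU1P[->|/ysub]; first by rewrite eqxx.
by rewrite mem_cat => /orP[->|->]; rewrite ?orbT.
Qed.

(** The induction builds, for each [k], a chain [c] of simplices of size [k] of
    sign vectors supported in the first [k] coordinates.  It is a cycle, it is
    invariant under the antipode, and it has an odd number of simplices whose
    labels alternate starting from the sign [true].  In the next dimension,
    [h = prism c + cone (e c)], where [e] sets the new coordinate to [+1] and the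
    apex of the cone is the unit vector below every [e X].  Its boundary is
    [c + e c + e c = c], so [h + antipode h] is an invariant cycle.  The simplices
    of [antipode h] that alternate from [true] correspond to the simplices of [h]
    that alternate from [false], so by [faces_alternating] the new count is the
    count of the alternating faces of [h], which is the odd count of [c]. *)
Theorem tucker (m : nat) (lam : N.-tuple sign -> nat) :
    (forall X, nonzero X -> lam (antipode X) = opp (lam X)) ->
    (forall X Y, nonzero X -> nonzero Y -> below X Y -> lam Y != opp (lam X)) ->
    (forall X, nonzero X -> (lam X)./2 < m) ->
  N <= m.
Proof.
move=> lamN lamC lamm.
pose chain k x := [&& size x == k, pairwise below x, all nonzero x & all (supported k) x].
have chainC k x : chain k x -> consistent (map lam x).
  case/and4P=> _ xx xn _ _ _ /mapP[X Xx ->] /mapP[Y Yx ->].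
  have C Z Z': Z \in x -> Z' \in x -> below Z Z' -> lam Z' != opp (lam Z).
    by move=> Zx Z'x; apply: lamC; apply: (allP xn).
  have: below X Y || below Y X.
    elim: x xx Xx Yx {xn C} => //= Z x IHx /andP[/allP Zx xx].
    rewrite !inE => /predU1P[->|Xx] /predU1P[->|Yx]; rewrite ?below_refl ?Zx ?orbT //.
    exact: IHx.
  case/orP=> [|/C]; first exact: C.
  by move=> /(_ Yx Xx); apply: contraNneq => ->; rewrite oppK.
suff H k : k <= N -> exists c : seq (seq (N.-tuple sign)),
   [/\ forall g, \xor_(x <- c) \xor_(y <- faces x) g y = false,
       forall g, \xor_(x <- c) g (map antipode x) = \xor_(x <- c) g x,
       {in c, forall x, chain k x}
     & \xor_(x <- c) alternating true (map lam x) = true].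
  have [c [_ _ cC]] := H N (leqnn N).
  have [/hasP[x xc xA] _|/hasPn cA] := boolP (has (fun x => alternating true (map lam x)) c).
    have xC := cC _ xc; have /and4P[/eqP sx _ xn _] := xC.
    rewrite -sx -(size_map lam); apply: alternating_size (chainC _ _ xC) xA _.
    by move=> _ /mapP[X Xx ->]; apply/lamm/(allP xn).
  by rewrite big_seq big1 // => x /cA/negbTE.
elim: k => [_|k IHk kN].
  exists [:: [::]]; split=> [g|g|x|]; rewrite ?big_seq1 //=; first by rewrite big_nil.
  by rewrite inE => /eqP ->.
have [c [c_bd c_anti c_chain c_alt]] := IHk (ltnW kN).
pose i := Ordinal kN; pose e := raise i; pose X0 : N.-tuple sign := e [tuple None | j < N].
pose h := flatten (map (prism e) c) ++ map (fun x => X0 :: map e x) c.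
have hE g : \xor_(x <- h) g x =
    (\xor_(x <- c) \xor_(z <- prism e x) g z) (+) \xor_(x <- c) g (X0 :: map e x).
  by rewrite big_cat big_flatten !big_map.
have h_bd g : \xor_(x <- h) \xor_(y <- faces x) g y = \xor_(x <- c) g x.
  rewrite hE; under eq_bigr do rewrite faces_prism.
  rewrite !big_split /= c_bd addFb -[RHS]addbF -addbA; congr (_ (+) _).
  under [X in _ (+) X]eq_bigr do rewrite big_cons big_map faces_map big_map.
  by rewrite big_split /= (c_bd (fun y => g (X0 :: map e y))) addbF addbb.
have h_chain : {in h, forall x, chain k.+1 x}.
  move=> z; rewrite mem_cat => /orP[/flatten_mapP[x xc zx]|/mapP[x xc ->]].
    have /and4P[/eqP sx xx xn xs] := c_chain _ xc.
    have [|sz zz zsub] := mem_prism _ (@raise_mono i) xx zx.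
      by move=> X Xx; exact: (@below_raise i X (allP xs _ Xx)).
    rewrite /chain sz sx eqxx zz /=; apply/andP; split; apply/allP => Y /zsub.
      by rewrite mem_cat => /orP[/(allP xn)//|/mapP[X _ ->]]; exact: nonzero_raise.
    rewrite mem_cat => /orP[/(allP xs)/supportedW//|/mapP[X /(allP xs) Xs ->]].
    exact: (supported_raise (i := i)).
  have /and4P[/eqP sx xx xn xs] := c_chain _ xc.
  rewrite /chain /= size_map sx eqxx /= !all_map pairwise_map nonzero_raise /=.
  rewrite -andbA; apply/and5P; split.
  - apply/allP=> X _ /=; apply: raise_mono; apply/belowP => j.
    by rewrite tnth_mktuple.
  - by apply: sub_pairwise xx => X Y; apply: raise_mono.
  - by apply/allP => X _; apply: nonzero_raise.
  - by apply: (supported_raise (i := i)); apply/forallP => j; rewrite tnth_mktuple implybT.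
  - by apply/allP => X /(allP xs); apply: (supported_raise (i := i)).
exists (h ++ map (map antipode) h); split=> [g|g||].
- rewrite big_cat /= big_map h_bd.
  under [X in _ (+) X]eq_bigr do rewrite faces_map big_map.
  by rewrite (h_bd (fun y => g (map antipode y))) c_anti addbb.
- rewrite [LHS]big_cat [RHS]big_cat /= !big_map addbC.
  by under eq_bigr do rewrite (mapK antipodeK).
- move=> x; rewrite mem_cat => /orP[/h_chain //|/mapP[y /h_chain]].
  rewrite /chain => /and4P[sy yy yn ys] ->; rewrite size_map sy pairwise_map !all_map /=.
  apply/and3P; split.
  + by apply: sub_pairwise yy => X Y; rewrite /= below_antipode.
  + by apply: sub_all yn => X; rewrite /= nonzero_antipode.
  + by apply: sub_all ys => X; rewrite /= supported_antipode.
rewrite big_cat /= big_map -big_split /=; apply: etrans c_alt.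
rewrite -(h_bd (fun x => alternating true (map lam x))).
apply: eq_big_seq => x xh.
have /and4P[_ _ xn _] := h_chain _ xh.
rewrite -[RHS](big_map (map lam) xpredT (alternating true)) -faces_map.
rewrite faces_alternating; congr (_ (+) _).
rewrite -(alternating_opp _ (chainC _ _ (h_chain _ xh))) -!map_comp.
by congr (alternating _ _); apply/eq_in_map => X /(allP xn)/lamN.
Qed.
End Tucker.

(** * The altermatic lower bound on the chromatic number *)

Lemma runs_first (s : seq sign) : has isSome s ->
  exists b, runs None s = (runs (Some b) s).+1 /\ runs (Some (~~ b)) s = runs None s.
Proof.
elim: s => [|[b|] s IHs] //= _.
by exists b; rewrite eqxx; split=> //; case: b.
Qed.

Lemma opp_bit (b : bool) (h : nat) : opp (b + h.*2) = ~~ b + h.*2.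
Proof. by rewrite /opp oddD oddb odd_double addbF; case: b. Qed.

(** A proper colouring with [k] colours gives a labelling of the nonzero sign
    vectors by [alt_ord sigma + k] absolute values.  If [X] has few alternations
    its label is its alternation number, signed by its first nonzero term.
    Otherwise one of the two sign classes contains a hyperedge and the label is
    the largest colour found in the two classes, signed by the class that it
    comes from. *)
Section LowerBound.
Variables (H : hypergraph) (sigma : #|hvert H|.-tuple (hvert H)) (k : nat).
Hypothesis sigma_uniq : uniq sigma.
Variable c : {ffun KG H -> 'I_k}.
Hypothesis c_proper : forall v w : KG H, adj v w -> c v != c w.

Local Notation N := #|hvert H|.
Implicit Types (X Y : N.-tuple sign) (v w : KG H).

Lemma mem_sign_part X b i : (tnth sigma i \in sign_part sigma X b) = (tnth X i == Some b).
Proof.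
apply/imsetP/idP => [[j]|Xi]; last by exists i; rewrite ?inE.
by rewrite inE => Xj /(tuple_uniqP _ sigma_uniq) ->.
Qed.

Lemma mem_sigma x : exists i, x = tnth sigma i.
Proof.
have /tnthP[i ->]: x \in sigma; last by exists i.
have [||_ ->] := uniq_min_size sigma_uniq (s2 := enum (hvert H)); rewrite ?mem_enum //.
  by move=> y _; rewrite mem_enum.
by rewrite !size_tuple.
Qed.

Lemma sign_part_antipode X b : sign_part sigma (antipode X) b = sign_part sigma X (~~ b).
Proof.
apply/setP=> x; have [i ->] := mem_sigma x; rewrite !mem_sign_part tnth_map.
by case: (tnth X i) => [[]|]; case: b.
Qed.

(** The two hyperedges lie in opposite sign classes of [Y], so they are disjoint
    and adjacent in the Kneser graph. *)
Lemma colors_differ X Y b v w : below X Y ->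
  val v \subset sign_part sigma X b -> val w \subset sign_part sigma Y (~~ b) ->
  c v != c w.
Proof.
move=> /belowP XY vX wY; apply: c_proper; apply/andP.
have vw: [disjoint val v & val w].
  rewrite disjoint_subset; apply/subsetP=> x xv; rewrite inE.
  apply: contraTN (subsetP vX x xv) => /(subsetP wY); have [i ->] := mem_sigma x.
  rewrite !mem_sign_part => Yi; apply: contraTN Yi => /eqP Xi.
  by rewrite XY Xi //; case: (b).
split=> //; apply: contraTneq vw => <-; rewrite -setI_eq0 setIid.
by apply: contraNneq (hedges_neq0 H) => <-; apply: valP.
Qed.

(** Colours are shifted by one, so that [0] means that there is no hyperedge. *)
Definition top_color X b : nat :=
  \max_(v : KG H | val v \subset sign_part sigma X b) (c v).+1.

Lemma top_color_attained X b : 0 < top_color X b ->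
  exists2 v : KG H, val v \subset sign_part sigma X b & top_color X b = (c v).+1.
Proof.
rewrite /top_color; pose P := [pred v : KG H | val v \subset sign_part sigma X b].
have [A0|A0] := posnP #|P|.
  by rewrite big_pred0 // => v; exact: (card0_eq A0).
by have [v] := eq_bigmax_cond (fun v => (c v).+1) A0; exists v.
Qed.

Lemma top_color_le X b : top_color X b <= k.
Proof. by apply/bigmax_leqP=> v _; apply: ltn_ord. Qed.

Lemma top_color_neq X Y b : below X Y -> 0 < top_color X b ->
  top_color X b != top_color Y (~~ b).
Proof.
move=> XY tX; apply: contraTneq (tX) => E.
have [v vX Ev] := top_color_attained tX.
rewrite E in tX; have [w wY Ew] := top_color_attained tX.
have := colors_differ XY vX wY; rewrite -(inj_eq val_inj) -eqSS -Ev -Ew.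
by rewrite E eqxx.
Qed.

Lemma top_color_antipode X b : top_color (antipode X) b = top_color X (~~ b).
Proof. by rewrite /top_color sign_part_antipode. Qed.

Definition few X : bool := runs None X <= alt_ord sigma.

Definition level X : nat :=
  if few X then (runs None X).-1
  else alt_ord sigma + (maxn (top_color X true) (top_color X false)).-1.

Definition label_sign X : bool :=
  if few X then runs (Some true) X < runs (Some false) X
  else top_color X false < top_color X true.

Definition label X : nat := label_sign X + (level X).*2.

Lemma top_color_gt0 X : ~~ few X -> 0 < maxn (top_color X true) (top_color X false).
Proof.
rewrite /few -ltnNge -alt_seqE => aX; rewrite leq_max.
have: contains_hedge (sign_part sigma X true) || contains_hedge (sign_part sigma X false).
  apply: contraLR aX; rewrite negb_or => XN; rewrite -leqNgt.
  exact: (leq_bigmax_cond (F := fun X : N.-tuple sign => alt_seq X)).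
have tc b : contains_hedge (sign_part sigma X b) -> 0 < top_color X b.
  case/existsP => B /andP[BH BX].
  by apply: leq_trans (leq_bigmax_cond (F := fun v : KG H => (c v).+1) (Sub B BH) _).
by case/orP=> /tc ->; rewrite ?orbT.
Qed.

Lemma nonzero_has X : nonzero X -> has isSome X.
Proof.
by case/existsP=> i Xi; apply/hasP; exists (tnth X i); [exact: mem_tnth|case: (tnth X i) Xi].
Qed.

Lemma runs_antipode p X : runs p (antipode X) = runs (omap negb p) X.
Proof. by rewrite -(runs_opp (omap negb p)); case: p => [[]|]. Qed.

Lemma label_sign_neq X : nonzero X -> 
  if few X then runs (Some true) X != runs (Some false) X
  else top_color X true != top_color X false.
Proof.
case: ifP => [_ /nonzero_has/runs_first[b [E1 E2]]|/negbT/top_color_gt0 X0 _].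
  by case: b E1 E2 => /=; lia.
move: X0; rewrite leq_max => /orP[X0|X0].
  exact: top_color_neq (below_refl X) X0.
by rewrite eq_sym; exact: top_color_neq (below_refl X) X0.
Qed.

Lemma label_antipode X : nonzero X -> label (antipode X) = opp (label X).
Proof.
move=> Xn; have := label_sign_neq Xn.
rewrite opp_bit /label /level /label_sign /few !runs_antipode !top_color_antipode /=.
by case: ifP => _; rewrite 1?maxnC; lia.
Qed.

Lemma runs_below X Y p : below X Y -> runs p X <= runs p Y.
Proof.
move=> /belowP XY; rewrite -(map_tnth_enum X) -(map_tnth_enum Y).
exact: runs_mono.
Qed.

(** For vectors with few alternations: if [X] is below [Y] and their first signs
    differ, then [Y] has more alternations than [X].  For the others, equal
    colours in opposite classes would contradict [colors_differ]. *)
Lemma label_below X Y : nonzero X -> nonzero Y -> below X Y -> label Y != opp (label X).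
Proof.
move=> Xn Yn XY; rewrite opp_bit; apply/eqP => E.
have E1 : label_sign Y = ~~ label_sign X.
  by have := congr1 odd E; rewrite /label !oddD !odd_double !oddb !addbF.
have E2 : level Y = level X.
  by have := congr1 half E; rewrite /label !half_bit_double.
have := label_sign_neq Xn; have := label_sign_neq Yn.
move: E1 E2; rewrite /label_sign /level.
have fYX : few Y -> few X by apply: leq_trans; exact: runs_below.
have rX0 : 0 < runs None X by have [b [-> _]] := runs_first (nonzero_has Xn).
have rY0 : 0 < runs None Y by have [b [-> _]] := runs_first (nonzero_has Yn).
case: (boolP (few Y)) => fY.
  rewrite (fYX fY); have [b [X1 X2]] := runs_first (nonzero_has Xn).
  have [b' [Y1 Y2]] := runs_first (nonzero_has Yn).
  have := runs_below (Some true) XY; have := runs_below (Some false) XY.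
  by case: b X1 X2; case: b' Y1 Y2 => /=; lia.
case: (boolP (few X)) => fX.
  by have := top_color_gt0 fY; move: fX; rewrite /few; lia.
have := top_color_gt0 fY; have := top_color_gt0 fX.
have := @top_color_neq X Y true XY; have := @top_color_neq X Y false XY => /=.
by lia.
Qed.

Lemma label_bound X : nonzero X -> (label X)./2 < alt_ord sigma + k.
Proof.
move=> Xn; rewrite /label half_bit_double /level.
have rX0 : 0 < runs None X by have [b [-> _]] := runs_first (nonzero_has Xn).
case: ifP => [|/negbT/top_color_gt0]; first by rewrite /few; lia.
by have := top_color_le X true; have := top_color_le X false; lia.
Qed.

Lemma vertices_le_alt_ord : N <= alt_ord sigma + k.
Proof. exact: tucker label_antipode label_below label_bound. Qed.

End LowerBound.

Lemma chiP (G : sgraph) (k : nat) : colorable G k -> chi G <= k.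
Proof. by rewrite /chi; case: ex_minnP => m _; exact. Qed.

Lemma chi_colorable (G : sgraph) : colorable G (chi G).
Proof. by rewrite /chi; case: ex_minnP. Qed.

Lemma chi_hom (F G : sgraph) : Defs.hom F G -> chi F <= chi G.
Proof.
case=> f fadj; apply: chiP; have /existsP[c /forallP cP] := chi_colorable G.
apply/existsP; exists [ffun x => c (f x)]; apply/forallP=> x; apply/forallP=> y.
apply/implyP=> /fadj xy; rewrite !ffunE.
exact: (implyP (forallP (cP (f x)) (f y)) xy).
Qed.

Theorem altermatic_le_chi (H : hypergraph) : #|hvert H| - alt H <= chi (KG H).
Proof.
rewrite leq_subLR /alt; elim/big_rec: _ => [|sigma m sU IHm].
  exact: leq_addr.
have /existsP[c /forallP cP] := chi_colorable (KG H).
have := @vertices_le_alt_ord H sigma (chi (KG H)) sU c _.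
rewrite /minn; case: ltnP => // _ /(_ _)-> // v w vw.
exact: (implyP (forallP (cP v) w) vw).
Qed.

(** * The upper bound by the Turan number *)

Lemma colorable_by (G : sgraph) (T : finType) (D : {set T}) (f : G -> T) :
    (forall v, f v \in D) -> (forall v w, adj v w -> f v != f w) ->
  colorable G #|D|.
Proof.
move=> fD fadj; apply/existsP; exists [ffun v => enum_rank_in (fD v) (f v)].
apply/forallP=> v; apply/forallP=> w; apply/implyP=> /fadj; rewrite !ffunE.
apply: contraNneq => E; rewrite -(enum_rankK_in (fD v) (fD v)) E.
by rewrite (enum_rankK_in (fD w) (fD w)).
Qed.

Lemma matchings_sub (T : finType) (E E' : {set {set T}}) (r : nat) :
  E \subset E' -> matchings E r \subset matchings E' r.
Proof.
move=> EE'; apply/subsetP=> M; rewrite !inE => /and3P[ME -> ->].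
by rewrite (subset_trans ME EE').
Qed.

Lemma ex_matching_attained (G : sgraph) (r : nat) : 0 < r ->
  exists S : {set {set G}}, [/\ S \subset edges G, matchings S r = set0
    & #|S| = ex_matching G r].
Proof.
move=> r0; pose A := [pred S : {set {set G}} | (S \subset edges G) && (matchings S r == set0)].
have A0 : 0 < #|A|.
  apply/card_gt0P; exists set0; rewrite inE sub0set; apply/eqP/setP=> M.
  rewrite !inE subset0; apply/negP=> /and3P[/eqP -> + _].
  by rewrite cards0 eq_sym (gtn_eqF r0).
have [S /andP[SE /eqP S0] ES] := eq_bigmax_cond (fun S : {set {set G}} => #|S|) A0.
by exists S.
Qed.

(** Each [r]-matching has an edge outside a fixed extremal [r]-matching-free set;
    colouring it by such an edge is proper, as adjacent vertices share no edge. *)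
Theorem chi_KG_matching_le (G : sgraph) (r : nat) : 0 < r ->
  chi (KG_matching G r) <= #|edges G| - ex_matching G r.
Proof.
move=> r0; have [S [SE S0 <-]] := ex_matching_attained G r0.
rewrite -(setIidPr SE) -cardsD; apply: chiP.
have out (v : KG_matching G r) : exists e, e \in val v :\: S.
  apply/set0Pn; apply/negP; rewrite setD_eq0 => vS.
  have: val v \in matchings S r.
    by have := valP v; rewrite !inE vS => /andP[].
  by rewrite S0 inE.
pose f v := xchoose (out v).
have fP v : f v \in val v /\ f v \notin S.
  by have := xchooseP (out v); rewrite inE => /andP[-> ->].
apply: (colorable_by (f := f)) => [v|v w /andP[_ vw]].
  have [fv fS] := fP v; rewrite inE fS /=.
  by have := valP v; rewrite inE => /andP[/subsetP/(_ _ fv)].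
have [fv _] := fP v; have [fw _] := fP w.
by apply: contraTneq fw => <-; rewrite (disjointFr vw fv).
Qed.

(** * Edge sets without a matching of size r *)

Section Matchings.
Variables (V : finType).
Implicit Types (P E M : {set {set V}}) (S T : {set V}).

Definition graphic E := {in E, forall e : {set V}, #|e| = 2}.

Definition incident E (v : V) : {set {set V}} := [set e in E | v \in e].

Definition touching E T : {set {set V}} := [set e in E | ~~ [disjoint e & T]].

Lemma edge_other E e v : graphic E -> e \in E -> v \in e ->
  exists2 y, y != v & e = [set v; y].
Proof.
move=> E2 /E2/eqP/cards2P[a [b [ab ->]]]; rewrite !inE => /orP[]/eqP->.
  by exists b; rewrite // eq_sym.
by exists a => //; rewrite setUC.
Qed.

Lemma subset_of_card (T : finType) (A : {set T}) k : k <= #|A| ->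
  exists2 B : {set T}, B \subset A & #|B| = k.
Proof.
move=> kA; exists [set x in take k (enum A)].
  by apply/subsetP=> x; rewrite inE => /mem_take; rewrite mem_enum.
rewrite cardsE (card_uniqP _) ?take_uniq ?enum_uniq //.
by rewrite size_takel // -cardE.
Qed.

(** Greedy extension: the edges of [M] and the vertices of [S] still to be
    saturated block fewer than [2 * r] endpoints, so a vertex of degree at least
    [2 * r] always has a free neighbour. *)
Lemma extend_matching P r M S : graphic P ->
    M \subset P -> trivIset M -> [disjoint S & cover M] ->
    {in S, forall v, 2 * r <= #|incident P v|} -> #|M| + #|S| = r ->
  matchings P r != set0.
Proof.
move=> P2; have [k] := ubnP #|S|; elim: k M S => // k IHk M S Sk MP Mt SM Sd rE.
have [S0|/set0Pn[v vS]] := eqVneq S set0.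
  apply/set0Pn; exists M; rewrite inE MP Mt andbT.
  by rewrite -rE S0 cards0 addn0 eqxx.
pose F := cover M :|: S :\ v.
have SE : #|S| = #|S :\ v|.+1 by rewrite (cardsD1 v) vS.
have F_small : #|F| < 2 * r.
  apply: leq_ltn_trans (leq_card_setU _ _) _.
  have: #|cover M| <= 2 * #|M|.
    apply: leq_trans (leq_card_cover M) _; rewrite mulnC -sum_nat_const.
    by apply: leq_sum => B BM; rewrite P2 // (subsetP MP).
  by lia.
have /subsetPn[e] : ~~ (incident P v \subset [set [set v; y] | y in F]).
  apply/negP=> /subset_leq_card; apply/negP; rewrite -ltnNge.
  by apply: leq_ltn_trans (leq_imset_card _ _) (leq_trans F_small (Sd v vS)).
rewrite inE => /andP[eP ve] eF; have [y yv eE] := edge_other P2 eP ve.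
have yF : y \notin F by apply: contra eF => yF; apply/imsetP; exists y.
have vM : v \notin cover M by rewrite (disjointFr SM vS).
have eM : [disjoint e & cover M].
  rewrite eE disjoints_subset subUset !sub1set !inE vM /=.
  by apply: contra yF; rewrite inE => ->.
have [|//||Mt' eM'] := @trivIsetU1 _ e M.
- by move=> B BM; apply: disjointWr eM; apply: bigcup_sup.
- by apply/negP=> /(subsetP MP)/P2; rewrite cards0.
apply: (IHk (e |: M) (S :\ v)).
- by rewrite -ltnS -SE.
- by rewrite subUset sub1set eP.
- exact: Mt'.
- rewrite /cover bigcup_setU big_set1 disjoint_sym disjoints_subset subUset.
  rewrite -!disjoints_subset; apply/andP; split; last first.
    by rewrite disjoint_sym; apply: disjointWl SM; apply: subD1set.
  rewrite eE disjoints_subset subUset !sub1set !inE eqxx /=.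
  by apply: contra yF; rewrite !inE => ->; rewrite orbT.
- by move=> w /setD1P[_ /Sd].
- by rewrite cardsU1 eM' -rE SE; lia.
Qed.

Section NoMatching.
Variables (P : {set {set V}}) (r : nat).
Hypotheses (P2 : graphic P) (P0 : matchings P r = set0).

(** The vertices of high degree almost form a vertex cover of a set without an
    [r]-matching: they are fewer than [r], and only a bounded number of edges
    avoid them. *)
Definition heavy : {set V} := [set v | 2 * r <= #|incident P v|].

Lemma card_heavy : #|heavy| < r.
Proof.
rewrite ltnNge; apply/negP => /subset_of_card[S SH Sr].
suff: matchings P r != set0 by rewrite P0 eqxx.
apply: (@extend_matching P r set0 S) => //; rewrite ?sub0set ?cards0 //.
- by apply/trivIsetP => A B; rewrite inE.
- by rewrite /cover big_set0 disjoint_sym disjoints_subset sub0set.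
- by move=> v /(subsetP SH); rewrite inE.
Qed.

Lemma light_edges_empty : #|heavy|.+1 = r -> touching P heavy = P.
Proof.
move=> Hr; apply/eqP; rewrite eqEsubset; apply/andP; split.
  by apply/subsetP => e; rewrite inE => /andP[].
apply/subsetP=> e eP; rewrite inE eP /=; apply/negP=> eH.
suff: matchings P r != set0 by rewrite P0 eqxx.
apply: (@extend_matching P r [set e] heavy) => //; rewrite ?sub1set ?cards1 //.
- by apply/trivIsetP => A B; rewrite !inE => /eqP -> /eqP ->; rewrite eqxx.
- by rewrite /cover big_set1 disjoint_sym.
- by move=> v; rewrite inE.
Qed.

(** The avoiding edges all meet a maximal matching among them, whose at most
    [2 * r] vertices have degree below [2 * r]. *)
Lemma card_light_edges : #|P :\: touching P heavy| <= 4 * r ^ 2.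
Proof.
set Q := P :\: _.
have QE e : (e \in Q) = (e \in P) && [disjoint e & heavy].
  by rewrite !inE; case: (e \in P) => //=; rewrite ?andbF ?negbK ?andbT.
pose good M := (M \subset Q) && trivIset M.
have [|M /maxsetP[/andP[MQ Mt] Mmax] _] := @maxset_exists _ good set0.
  by rewrite /good sub0set; apply/trivIsetP => A B; rewrite inE.
have MP : M \subset P.
  by apply: subset_trans MQ _; apply: subsetDl.
have Mr : #|M| < r.
  rewrite ltnNge; apply/negP => /subset_of_card[B BM Br].
  suff: B \in matchings P r by rewrite P0 inE.
  by rewrite inE (subset_trans BM MP) Br eqxx /= (trivIsetS BM Mt).
have Mc : #|cover M| <= 2 * r.
  apply: leq_trans (leq_card_cover M) _.
  apply: (@leq_trans (\sum_(A in M) 2)).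
    by apply: leq_sum => A AM; rewrite P2 // (subsetP MP).
  by rewrite sum_nat_const mulnC leq_mul2l /= ltnW.
have QM : Q \subset \bigcup_(v in cover M) incident P v.
  apply/subsetP=> e eQ; have := eQ; rewrite QE => /andP[eP eH].
  suff: ~~ [disjoint e & cover M].
    case/pred0Pn=> v /andP[/= ve vM]; apply/bigcupP; exists v => //.
    by rewrite inE eP.
  apply/negP => eM.
  have [|//||Mt' eM'] := @trivIsetU1 _ e M.
  - by move=> B BM; apply: disjointWr eM; apply: bigcup_sup.
  - by apply/negP=> /(subsetP MP)/P2; rewrite cards0.
  have := Mmax (e |: M); rewrite /good subUset sub1set eQ MQ Mt' subsetUr => /(_ isT isT) E.
  by rewrite -E setU11 in eM'.
apply: leq_trans (subset_leq_card QM) _.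
apply: leq_trans (_ : _ <= \sum_(v in cover M) #|incident P v|) _.
  elim/big_rec2: _ => [|v n A _ An]; first by rewrite cards0.
  by apply: leq_trans (leq_card_setU _ _) _; rewrite leq_add2l.
apply: (@leq_trans (\sum_(v in cover M) 2 * r)).
  apply: leq_sum => v /bigcupP[e /(subsetP MQ)]; rewrite QE => /andP[_ eH] ve.
  by have := disjointFr eH ve; rewrite inE => /negbT; rewrite -ltnNge => /ltnW.
by rewrite sum_nat_const; nia.
Qed.

End NoMatching.

Lemma touching_no_matching E T r : #|T| < r -> matchings (touching E T) r = set0.
Proof.
move=> Tr; apply/setP=> M; rewrite inE [RHS]inE; apply/negP.
case/and3P=> /subsetP MT /eqP Mr Mt; move: Tr; rewrite -Mr ltnNge => /negP; apply.
have ex e : e \in M -> exists v, v \in e :&: T.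
  by move/MT; rewrite inE => /andP[_]; rewrite -setI_eq0 => /set0Pn.
have [->|/set0Pn[e0 e0M]] := eqVneq M set0; first by rewrite cards0.
have [v0 _] := ex _ e0M.
pose f e := odflt v0 [pick v in e :&: T].
have fP e : e \in M -> f e \in e :&: T.
  by move/ex=> [v ve]; rewrite /f; case: pickP => [//|/(_ v)]; rewrite ve.
rewrite -(card_in_imset (f := f)).
  by apply/subset_leq_card/subsetP=> _ /imsetP[e /fP + ->]; rewrite inE => /andP[].
move=> e e' eM e'M fE; apply/eqP/negPn/negP => ee'.
have := trivIsetP Mt _ _ eM e'M ee'; move: (fP _ eM) (fP _ e'M).
rewrite -fE !inE => /andP[fe _] /andP[fe' _] /disjointFr/(_ fe).
by rewrite fe'.
Qed.

(** Only the at most [#|T| ^ 2] edges inside [T] are counted twice on the left. *)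
Lemma sum_card_touching E T : graphic E ->
  \sum_(e in E) #|e :&: T| <= #|touching E T| + #|T| ^ 2.
Proof.
move=> E2; pose I := [set e in E | e \subset T].
have IT : #|I| <= #|T| ^ 2.
  apply: (@leq_trans #|[set [set u.1; u.2] | u in setX T T]|).
    apply/subset_leq_card/subsetP=> e; rewrite inE => /andP[/E2/eqP/cards2P].
    case=> a [b [_ ->]]; rewrite subUset !sub1set => /andP[aT bT].
    by apply/imsetP; exists (a, b); rewrite // inE aT.
  by apply: leq_trans (leq_imset_card _ _) _; rewrite cardsX.
apply: leq_trans (leq_add (leqnn _) IT); rewrite -!sum1_card.
rewrite [X in _ <= X + _](eq_bigl (fun e => (e \in E) && ~~ [disjoint e & T])); last by move=> e; rewrite inE.
rewrite [X in _ <= _ + X](eq_bigl (fun e => (e \in E) && (e \subset T))); last by move=> e; rewrite inE.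
rewrite !big_mkcondr -big_split; apply: leq_sum => e /E2 e2 /=.
have [|_] := boolP [disjoint e & T]; first by rewrite -setI_eq0 => /eqP ->; rewrite cards0.
have [_|eT] := boolP (e \subset T).
  by apply: leq_trans (subset_leq_card (subsetIl _ _)) _; rewrite e2.
rewrite addn0 -ltnS -e2; apply: proper_card.
by rewrite properE subsetIl /= subsetI subxx.
Qed.

Lemma card_touchingU1 E T y : graphic E -> y \notin T ->
  #|touching E T| + #|incident E y| <= #|touching E (y |: T)| + #|T|.
Proof.
move=> E2 yT; rewrite -(cardsID (touching E T) (incident E y)) addnCA addnC.
apply: leq_add; last first.
  apply: (@leq_trans #|[set [set y; z] | z in T]|); last exact: leq_imset_card.
  apply/subset_leq_card/subsetP=> e; rewrite !inE => /andP[/andP[eE ye] /andP[_ eT]].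
  have [z zy eE'] := edge_other E2 eE ye; apply/imsetP; exists z => //.
  by move: eT; rewrite eE' disjoints_subset subUset !sub1set !inE yT /= negbK.
rewrite -cardsUI.
have ->: touching E T :&: (incident E y :\: touching E T) = set0.
  by rewrite setIDA setIC -setIDA setDv setI0.
rewrite cards0 addn0.
apply/subset_leq_card/subsetP=> e; rewrite !inE.
case/orP => [/andP[-> eT]|/andP[_ /andP[-> ye]]] /=.
  by apply: contra eT; apply: disjointWr; exact: subsetUr.
by apply/pred0Pn; exists y; rewrite /= ye !inE eqxx.
Qed.

End Matchings.

(** * Balanced orientations *)

Section Orientation.
Variable V : finType.
Implicit Types (p q : V * V) (s t : seq (V * V)).

Definition edge_of p : {set V} := [set p.1; p.2].

Lemma set2_eq (a b x y : V) : [set a; b] = [set x; y] ->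
  (a = x /\ b = y) \/ (a = y /\ b = x).
Proof.
move=> E.
have ha : a \in [set x; y] by rewrite -E set21.
have hb : b \in [set x; y] by rewrite -E set22.
have hx : x \in [set a; b] by rewrite E set21.
have hy : y \in [set a; b] by rewrite E set22.
case/set2P: ha => Ea; case/set2P: hb => Eb; case/set2P: hx => Ex;
  case/set2P: hy => Ey; solve [left; split; congruence | right; split; congruence].
Qed.

Lemma count_ge2 (T : eqType) (a : pred T) (s : seq T) : 1 < count a s ->
  exists (p q : T) (s' : seq T), [/\ a p, a q & perm_eq s (p :: q :: s')].
Proof.
move=> as2; have /hasP[p ps ap] : has a s by rewrite has_count ltnW.
have E := perm_to_rem ps; move/permP: (E) => /(_ a) /=; rewrite ap => as1.
have /hasP[q qs aq] : has a (rem p s) by rewrite has_count; lia.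
exists p, q, (rem q (rem p s)); split=> //.
by apply: perm_trans E _; rewrite perm_cons perm_to_rem.
Qed.

(** Splitting off: if [p] and [q] both enter [v], replace them by a single edge
    between their other ends, orient the smaller multigraph, and reroute that edge
    through [v], which adds one to both degrees of [v] and changes no other
    degree.  Loops created on the way are harmless.  If no vertex is entered
    twice, the given orientation is balanced. *)
Lemma balanced_orientation s : exists t,
  perm_eq (map edge_of t) (map edge_of s) /\
  forall v, count (fun p => p.2 == v) t <= (count (fun p => p.1 == v) t).+1.
Proof.
have [n] := ubnP (size s); elim: n s => // n IHn s sn.
have [/existsP[v /count_ge2[p [q [s' [/eqP pv /eqP qv ss']]]]]|] :=
    boolP [exists v, 1 < count (fun p => p.2 == v) s]; last first.
  move=> /existsPn sv; exists s; split=> // v.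
  by have := sv v; rewrite -leqNgt => /leq_trans->.
have [|t' [tE tB]] := IHn ((p.1, q.1) :: s').
  by move: sn; rewrite (perm_size ss') /=; lia.
have : [set p.1; q.1] \in map edge_of t'.
  by rewrite (perm_mem tE) /= inE eqxx.
case/mapP => a at' aE; have tP := perm_to_rem at'.
exists ((a.1, v) :: (v, a.2) :: rem a t'); split.
  rewrite (permPr (perm_map edge_of ss')) /=.
  have E : perm_eq (map edge_of (rem a t')) (map edge_of s').
    rewrite -(perm_cons (edge_of a)) -map_cons -(permPl (perm_map edge_of tP)).
    by rewrite (permPl tE) /= [edge_of (_, _)]aE.
  rewrite /edge_of /= pv qv [[set v; a.2]]setUC.
  by case: (set2_eq aE) => -[-> ->]; rewrite ?perm_cons // -cat1s -[X in perm_eq _ X]cat1s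
     (perm_catCA [:: _] [:: _]) /= !perm_cons.
move=> w; have := tB w; rewrite !(permP tP) /=; lia.
Qed.

Definition star t (w : V) : seq (V * V) := [seq p <- t | p.1 == w].

Definition stars t : seq (V * V) := flatten [seq star t w | w <- enum V].

Lemma perm_stars t : perm_eq (stars t) t.
Proof.
apply/permP => a; rewrite count_flatten -map_comp sumnE big_map big_enum /=.
under eq_bigr => w _ do rewrite /= count_filter -sum1_count.
rewrite -sum1_count; under eq_bigr do rewrite big_mkcond.
rewrite exchange_big [RHS]big_mkcond /=; apply: eq_bigr => p _.
rewrite (bigD1 p.1) //= eqxx andbT big1 ?addn0 // => w wp.
by rewrite eq_sym (negbTE wp) andbF.
Qed.

End Orientation.

(** * The cost of a gadget *)

(** The signing [x] gives a sign [b] only to edges that meet [S b].  Each vertex is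
    weighted by the number of the two sets that contain it.  A segment of the
    edge order is balanced if twice its number of runs is at most the total weight
    of its edges.  For a gadget this means that a vertex in just one of the two
    sets pays one run for two edges. *)
Section Cost.
Variables (V : finType) (S : bool -> {set V}) (x : {set V} -> sign).
Hypothesis xS : forall e b, x e = Some b -> ~~ [disjoint e & S b].

Definition vweight (v : V) : nat := (v \in S true) + (v \in S false).

Definition weight (e : {set V}) : nat := #|e :&: S true| + #|e :&: S false|.

Local Notation U := (S true :|: S false).

Lemma weight2 a b : a != b -> weight [set a; b] = vweight a + vweight b.
Proof.
move=> ab; have E (T : {set V}) : #|[set a; b] :&: T| = (a \in T) + (b \in T).
  rewrite -sum1_card (eq_bigl (fun v => (v \in [set a; b]) && (v \in T))).
    by rewrite big_mkcondr big_setU1 ?inE // big_set1; do 2!case: (_ \in T).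
  by move=> v; rewrite inE.
by rewrite /weight /vweight !E; lia.
Qed.

Lemma sign2 a b c : x [set a; b] = Some c -> (a \in S c) || (b \in S c).
Proof.
by move/xS; rewrite disjoints_subset subUset !sub1set !inE negb_and !negbK.
Qed.

Lemma mem_supportE v : (v \in U) = (0 < vweight v).
Proof. by rewrite inE /vweight; case: (v \in S true); case: (v \in S false). Qed.

Lemma mem_support c v : v \in S c -> v \in U.
Proof. by case: c; rewrite inE => ->; rewrite ?orbT. Qed.

Lemma vweight1P v : vweight v = 1 -> exists2 b, v \in S b & v \notin S (~~ b).
Proof.
rewrite /vweight; case T: (v \in S true); case F: (v \in S false) => // _.
  by exists true; rewrite ?T ?F.
by exists false; rewrite ?T ?F.
Qed.

(** A gadget is a copy of [K_{2,4}] with sides [{u, w}] and [{a, b, c, d}],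
    traversed as the closed trail [u a w b u c w d u].  At each visit of a
    vertex other than [u] its two edges are consecutive, so such a vertex costs no
    more than its share.  If no vertex but the centre [u] lies in the two sets,
    then the four edges at [u] form one run instead of the two allowed. *)
Definition gadget : Type := V * V * (V * V * V * V).

Definition center (g : gadget) : V := g.1.1.
Definition hub (g : gadget) : V := g.1.2.
Definition rim (g : gadget) : seq V :=
  let: (_, _, (a, b, c, d)) := g in [:: a; b; c; d].

Definition zigzag (g : gadget) : seq {set V} :=
  let: (u, w, (a, b, c, d)) := g in
  [:: [set u; a]; [set a; w]; [set w; b]; [set b; u];
      [set u; c]; [set c; w]; [set w; d]; [set d; u]].

(** The saving at the centre may be lost in a hit gadget. *)
Definition hit (g : gadget) : bool := has (mem U) (hub g :: rim g).

Lemma runs_half_zigzag (pa pw pb : bool -> bool) (s1 s2 s3 s4 : sign) :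
    (forall c, s1 = Some c -> pa c) -> (forall c, s2 = Some c -> pa c || pw c) ->
    (forall c, s3 = Some c -> pw c || pb c) -> (forall c, s4 = Some c -> pb c) ->
  runs None [:: s1; s2; s3; s4] <=
  (pa true + pa false) + (pw true + pw false) + (pb true + pb false).
Proof.
move=> h1 h2 h3 h4.
case: s1 h1 => [c1 /(_ c1 erefl)|_]; case: s2 h2 => [c2 /(_ c2 erefl)|_];
case: s3 h3 => [c3 /(_ c3 erefl)|_]; case: s4 h4 => [c4 /(_ c4 erefl)|_] /=;
do ?[case: c1]; do ?[case: c2]; do ?[case: c3]; do ?[case: c4];
move: (pa true) (pa false) (pw true) (pw false) (pb true) (pb false);
by do 6!case.
Qed.

Lemma gadget_cost (g : gadget) : uniq (center g :: hub g :: rim g) ->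
  2 * runs None (map x (zigzag g)) + 2 * ((vweight (center g) == 1) && ~~ hit g) <=
  \sum_(e <- zigzag g) weight e + 16 * ((center g \in U) && hit g).
Proof.
case: g => [[u w] [[[a b] c] d]].
move Dr: (runs _ _) => r; move Dh: (hit _) => h; rewrite -[center _]/u.
move=> gU; have [/and5P[uw ua ub uc ud] /and4P[wa wb wc wd]] :
    [&& u != w, u != a, u != b, u != c & u != d] /\ [&& w != a, w != b, w != c & w != d].
  by move: gU; rewrite /= !inE !negb_or => /and5P[-> -> _ _ _].
have Ew : \sum_(e <- zigzag (u, w, (a, b, c, d))) weight e =
    4 * vweight u + 4 * vweight w + 2 * (vweight a + vweight b + vweight c + vweight d).
  rewrite /zigzag !big_cons big_nil !weight2 //; try by rewrite eq_sym.
  by clear; lia.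
rewrite Ew.
have r8 : r <= 8 by rewrite -Dr; apply: leq_trans (runs_le_count _ _) (count_size _ _).
have [uU|uU] := boolP (u \in U); last first.
  have u0 : vweight u = 0 by apply/eqP; rewrite -leqn0 leqNgt -mem_supportE.
  have uN s : u \notin S s by apply: contra uU; apply: mem_support.
  have half a' b' : runs None [:: x [set u; a']; x [set a'; w]; x [set w; b']; x [set b'; u]]
      <= vweight a' + vweight w + vweight b'.
    apply: (@runs_half_zigzag (fun s => a' \in S s) (fun s => w \in S s) (fun s => b' \in S s)).
    - by move=> s /sign2; rewrite (negbTE (uN s)).
    - by move=> s /sign2.
    - by move=> s /sign2.
    - by move=> s /sign2; rewrite (negbTE (uN s)) orbF.
  pose l a' b' := [:: x [set u; a']; x [set a'; w]; x [set w; b']; x [set b'; u]].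
  have rE : r <= runs None (l a b) + runs None (l c d) by rewrite -Dr; apply: runs_cat.
  have := leq_trans rE (leq_add (half a b) (half c d)).
  by rewrite u0; clear; lia.
case: h Dh => [_|/negbT]; first by rewrite /= andbF; clear -r8; lia.
rewrite /hit /= !negb_or => /and5P[wU aU bU cU /andP[dU _]].
have Ux v s : v \notin U -> x [set u; v] = Some s -> u \in S s.
  by move=> vU /sign2/orP[//|/mem_support]; rewrite (negbTE vU).
have U0 v v' : v \notin U -> v' \notin U -> x [set v; v'] = None.
  move=> vU vU'; case E: (x _) => [s|] //.
  by case/orP: (sign2 E) => /mem_support; rewrite ?(negbTE vU) ?(negbTE vU').
move: r8; rewrite -{}Dr /zigzag [map _ _]/= (U0 a w) // (U0 w b) // (U0 c w) // (U0 w d) //.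
rewrite -![[set _; u]]setUC.
have := mem_supportE u; rewrite uU => u0.
have [u1|u1] := eqVneq (vweight u) 1; last first.
  have u2 : 1 < vweight u by rewrite ltn_neqAle eq_sym u1 -u0.
  set s := [:: _, _ & _] => _.
  have s4 : runs None s <= 4.
    apply: leq_trans (runs_le_count _ _) _; rewrite /s /=.
    by case: (x _) => [?|]; case: (x _) => [?|]; case: (x _) => [?|]; case: (x _) => [?|].
  by move: (runs None s) s4; clear -u2 => r; lia.
move=> _; have [s us uNs] := vweight1P u1.
have X v : v \notin U -> x [set u; v] = Some s \/ x [set u; v] = None.
  move=> vU; case E: (x _) => [s'|]; [left|by right]; congr Some.
  by move: uNs (Ux _ _ vU E); case: (s); case: s' {E} => //= /negbTE->.
have: forall l : seq sign, all (fun y => (y == Some s) || (y == None)) l -> runs None l <= 1.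
  have H (l : seq sign) : all (fun y => (y == Some s) || (y == None)) l ->
     runs (Some s) l = 0.
    elim: l => [|[b'|] l IHl] //= /andP[/orP[/eqP[->]|//] /IHl->].
    by rewrite eqxx.
  by move=> l /H l0; have := runs_None_le (Some s) l; rewrite l0.
set l := [:: _, _ & _] => /(_ l) Hl; have {Hl} : runs None l <= 1.
  apply: Hl; rewrite /l /=.
  by case: (X a aU) => ->; case: (X b bU) => ->; case: (X c cU) => ->; case: (X d dU) => ->;
     rewrite ?eqxx ?orbT.
by move: (runs None l) u1; clear => r u1; rewrite u1; lia.
Qed.

End Cost.

(** * The cost of an edge order *)

Lemma sum_by_value (T : eqType) (V : finType) (f : T -> V) (g : V -> nat) (s : seq T) :
  \sum_(p <- s) g (f p) = \sum_v g v * count (fun p => f p == v) s.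
Proof.
under [RHS]eq_bigr => v _ do rewrite -sum1_count big_mkcond big_distrr.
rewrite exchange_big; apply: eq_bigr => p _.
rewrite (bigD1 (f p)) //= eqxx muln1 big1 ?addn0 // => v vp.
by rewrite eq_sym (negbTE vp) muln0.
Qed.

Lemma count_le1 (T : eqType) (P : pred T) (s : seq T) : uniq s ->
  {in s &, forall g h, P g -> P h -> g = h} -> count P s <= 1.
Proof.
move=> su sP; rewrite leqNgt; apply/negP => /count_ge2[g [h [s' [Pg Ph E]]]].
have gh : g = h by apply: sP; rewrite ?(perm_mem E) ?inE ?eqxx ?orbT.
by move: su; rewrite (perm_uniq E) gh /= inE eqxx.
Qed.

Lemma flatten_uniq_inj (T U : eqType) (f : T -> seq U) (s : seq T) (e : U) :
  uniq (flatten (map f s)) -> {in s &, forall g h, e \in f g -> e \in f h -> g = h}.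
Proof.
elim: s => //= a s IHs; rewrite cat_uniq => /and3P[_ /hasPn D su] g h.
have no k : k \in s -> e \in f k -> e \in f a -> False.
  move=> ks ek ea; have eF : e \in flatten (map f s) by apply/flatten_mapP; exists k.
  by move: (D e eF); rewrite /= ea.
rewrite !inE => /predU1P[->|gs] /predU1P[->|hs] // eg eh.
- by case: (no h hs eh eg).
- by case: (no g gs eg eh).
- exact: IHs.
Qed.

Lemma flatten_uniq (T U : eqType) (f : T -> seq U) (s : seq T) :
  (forall g, f g != [::]) -> uniq (flatten (map f s)) -> uniq s.
Proof.
move=> f0; elim: s => //= a s IHs; rewrite cat_uniq => /and3P[_ /hasPn D /IHs ->].
rewrite andbT; apply/negP=> as_; case Ef: (f a) (f0 a) => [|e l] // _.
have ea : e \in f a by rewrite Ef mem_head.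
have eF : e \in flatten (map f s) by apply/flatten_mapP; exists a.
by move: (D e eF); rewrite /= ea.
Qed.

Lemma uniq_map_inj (T U : eqType) (f : T -> U) (s : seq T) :
  uniq (map f s) -> {in s &, injective f}.
Proof.
elim: s => //= a s IHs /andP[fa /IHs {}IHs] g h; rewrite !inE.
move=> /predU1P[->|gs] /predU1P[->|hs] // E.
- by case/negP: fa; rewrite E map_f.
- by case/negP: fa; rewrite -E map_f.
- exact: IHs.
Qed.

Section OrderCost.
Variables (V : finType) (S : bool -> {set V}) (x : {set V} -> sign).
Hypothesis xS : forall e b, x e = Some b -> ~~ [disjoint e & S b].
Local Notation U := (S true :|: S false).

(** In an out-star, a centre lying in one of the two sets costs one run up to the
    interruptions by other relevant edges, while each other relevant vertex pays
    for its own edge. *)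
Lemma star_cost (t : seq (V * V)) w : uniq (map (@edge_of V) t) ->
  2 * runs None [seq x (edge_of p) | p <- star t w] <=
  (vweight S w == 2) * (2 * size (star t w)) + 2 * count (fun p => p.2 \in U) (star t w)
    + (vweight S w == 1) * (2 + 2 * #|U|).
Proof.
move=> tu; set s := star t w; set m := count _ s.
have sw p : p \in s -> p.1 = w by rewrite mem_filter => /andP[/eqP].
have xw p c : p \in s -> x (edge_of p) = Some c -> (w \in S c) || (p.2 \in S c).
  by move=> ps /(sign2 xS); rewrite (sw p ps).
have mU : m <= #|U|.
  rewrite /m -size_filter -(size_map snd) cardE; apply: uniq_leq_size.
    rewrite map_inj_in_uniq ?filter_uniq //; last first.
      move=> p q; rewrite !mem_filter => /andP[_ ps] /andP[_ qs] pq.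
      by rewrite [p]surjective_pairing [q]surjective_pairing pq !sw ?mem_filter.
    exact: map_uniq tu.
  by move=> y /mapP[p + ->]; rewrite mem_filter mem_enum => /andP[].
have bound (a : pred sign) : (forall p, p \in s -> a (x (edge_of p)) -> p.2 \in U) ->
    count a [seq x (edge_of p) | p <- s] <= m.
  move=> ha; rewrite count_map /m -!size_filter.
  have -> : [seq p <- s | a (x (edge_of p))] =
     [seq p <- [seq p <- s | p.2 \in U] | a (x (edge_of p))].
    rewrite -filter_predI; apply: eq_in_filter => p ps /=.
    by case ap: (a _) => //=; rewrite ha.
  by rewrite size_filter count_size.
have [u0|u0] := posnP (vweight S w).
  have wU c : w \notin S c by apply/negP=> /mem_support; rewrite mem_supportE u0.
  rewrite u0 /= add0n addn0 leq_mul2l /=.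
  apply: leq_trans (runs_le_count _ _) (bound _ _) => p ps.
  by case E: (x _) => [c|] // _; have := xw p c ps E; rewrite (negbTE (wU c)) => /mem_support.
have [u1|u1] := eqVneq (vweight S w) 1.
  have [b wb wNb] := vweight1P u1.
  have := runs_minority b [seq x (edge_of p) | p <- s].
  have : count (pred1 (Some (~~ b))) [seq x (edge_of p) | p <- s] <= m.
    apply: bound => p ps /eqP E; have := xw p _ ps E.
    by rewrite (negbTE wNb) => /mem_support.
  rewrite u1 /=; move: (count (pred1 _) _) (runs _ _) (#|_|) mU; clear; lia.
have -> : vweight S w = 2 by move: u0 u1; rewrite /vweight; case: (w \in S true); case: (w \in S false).
have := runs_le_count None [seq x (edge_of p) | p <- s].
have := count_size isSome [seq x (edge_of p) | p <- s]; rewrite size_map /=.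
by move: (count isSome _) (runs _ _) (size _); clear; lia.
Qed.

(** A vertex in one of the two sets pays for its in-edges and not for its
    out-edges, that is for half of its degree because the orientation is
    balanced. *)
Lemma stars_cost (t : seq (V * V)) : uniq (map (@edge_of V) t) ->
    {in t, forall p, p.1 != p.2} ->
    (forall v, count (fun p => p.2 == v) t <= (count (fun p => p.1 == v) t).+1) ->
  2 * runs None [seq x (edge_of p) | p <- stars t] <=
  \sum_(e <- map (@edge_of V) t) weight S e + #|U| * (3 + 2 * #|U|).
Proof.
move=> tu tl tb; rewrite map_flatten -map_comp.
apply: leq_trans (leq_mul (leqnn 2) (runs_flatten _)) _.
rewrite big_map big_enum big_distrr /=.
apply: leq_trans (leq_sum _ (fun w _ => star_cost w tu)) _.
have ->: \sum_(e <- map (@edge_of V) t) weight S e =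
   \sum_v vweight S v * (count (fun p => p.1 == v) t + count (fun p => p.2 == v) t).
  rewrite big_map (eq_big_seq (fun p : V * V => vweight S p.1 + vweight S p.2)); last first.
    by move=> p /tl pp; rewrite -(weight2 S pp).
  rewrite big_split /= !sum_by_value -big_split /=.
  by apply: eq_bigr => v _; rewrite mulnDr.
have ->: \sum_w ((vweight S w == 2) * (2 * size (star t w)) +
     2 * count (fun p => p.2 \in U) (star t w) + (vweight S w == 1) * (2 + 2 * #|U|)) =
   \sum_w ((vweight S w == 2) * (2 * count (fun p => p.1 == w) t) +
     2 * ((w \in U) * count (fun p => p.2 == w) t) + (vweight S w == 1) * (2 + 2 * #|U|)).
  rewrite [LHS]big_split [RHS]big_split [X in X + _ = _]big_split [X in _ = X + _]big_split /=.
  congr (_ + _ + _).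
    by apply: eq_bigr => w _; rewrite size_filter.
  rewrite -[LHS](big_distrr 2) -[RHS](big_distrr 2) /=; congr (2 * _).
  rewrite -(sum_by_value snd (fun v => (v \in U) : nat)).
  transitivity (count (fun p => p.2 \in U) t).
    rewrite -(permP (perm_stars t)) count_flatten -map_comp sumnE.
    by rewrite big_map big_enum.
  by rewrite -sum1_count big_mkcond; apply: eq_bigr => p _; case: (_ \in _).
rewrite -sum_nat_const [X in _ <= _ + X]big_mkcond -big_split /=.
apply: leq_sum => v _; have := tb v; have := mem_supportE S v.
have : vweight S v <= 2 by rewrite /vweight; do 2!case: (_ \in _).
move: (count _ t) (count _ t) (#|_|) => i o n.
by case: (vweight S v) => [|[|[|//]]] _ -> /=; clear; lia.
Qed.

Variable gs : seq (gadget V).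
Hypothesis gs_proper : {in gs, forall g, uniq (center g :: hub g :: rim g)}.
Hypothesis gs_uniq : uniq (flatten (map (@zigzag V) gs)).
Hypothesis gs_hubs : uniq [seq (center g, hub g) | g <- gs].

(** For a given centre and a given other vertex, at most one gadget has that vertex
    as hub, and at most one has it on its rim, because gadgets share no edge. *)
Lemma count_hit : count (fun g => (center g \in U) && hit S g) gs <= 2 * #|U| ^ 2.
Proof.
have gu : uniq gs by apply: flatten_uniq gs_uniq => -[[u w] [[[a b] c] d]].
pose P u v (g : gadget V) := (center g == u) && (hub g == v).
pose Q u v (g : gadget V) := (center g == u) && (v \in rim g).
have P1 u v : count (P u v) gs <= 1.
  apply: count_le1 gu _ => g h gg hg /andP[/eqP Eg /eqP Fg] /andP[/eqP Eh /eqP Fh].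
  by apply: (uniq_map_inj gs_hubs gg hg); rewrite Eg Fg Eh Fh.
have Q1 u v : count (Q u v) gs <= 1.
  apply: count_le1 gu _ => g h gg hg /andP[/eqP Eg Fg] /andP[/eqP Eh Fh].
  have Z k : center k = u -> v \in rim k -> [set u; v] \in zigzag k.
    case: k => [[u' w] [[[a b] c] d]]; rewrite /center /= => ->.
    by rewrite !inE => /or4P[]/eqP->; rewrite ?eqxx ?orbT // [[set u; _]]setUC eqxx ?orbT.
  exact: flatten_uniq_inj gs_uniq _ _ gg hg (Z _ Eg Fg) (Z _ Eh Fh).
have sumE (R : pred (gadget V)) : count R gs = \sum_(g <- gs) R g.
  by rewrite -sum1_count big_mkcond; apply: eq_bigr => g _; case: (R g).
apply: (@leq_trans (\sum_(g <- gs) \sum_(u in U) \sum_(v in U) (P u v g + Q u v g))).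
  rewrite sumE; apply: leq_sum => g _.
  case: (boolP (_ && _)) => // /andP[cU /hasP[v vg /= vU]].
  rewrite (bigD1 (center g)) //= (bigD1 v) //= /P /Q eqxx /=.
  by move: vg; rewrite inE eq_sym => /orP[->|->]; rewrite ?addn1 ?add1n ?addnS.
rewrite exchange_big -mulnn mulnA mulnC -sum_nat_const; apply: leq_sum => u _.
rewrite exchange_big mulnC -sum_nat_const; apply: leq_sum => v _.
by rewrite big_split /= -!sumE; apply: (leq_add (P1 u v) (Q1 u v)).
Qed.

Lemma gadgets_cost :
  2 * runs None (map x (flatten (map (@zigzag V) gs))) +
    2 * count (fun g => (vweight S (center g) == 1) && ~~ hit S g) gs <=
  \sum_(e <- flatten (map (@zigzag V) gs)) weight S e +
    16 * count (fun g => (center g \in U) && hit S g) gs.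
Proof.
have sumE (P : pred (gadget V)) : count P gs = \sum_(g <- gs) P g.
  by rewrite -sum1_count big_mkcond; apply: eq_bigr => g _; case: (P g).
rewrite !sumE big_flatten big_map /= !big_distrr -big_split /=.
apply: (@leq_trans (\sum_(g <- gs) (2 * runs None (map x (zigzag g)) +
    2 * ((vweight S (center g) == 1) && ~~ hit S g)))).
  rewrite [X in _ <= X]big_split leq_add2r -[X in _ <= X]big_distrr leq_mul2l /= map_flatten -map_comp.
  by apply: leq_trans (runs_flatten _) _; rewrite big_map.
rewrite !big_seq; apply: leq_sum => g gg; exact: gadget_cost (gs_proper gg).
Qed.

Lemma unhit_many (K : nat) u : vweight S u = 1 -> K <= count (fun g => center g == u) gs ->
  K <= count (fun g => (vweight S (center g) == 1) && ~~ hit S g) gs + 2 * #|U| ^ 2.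
Proof.
move=> u1 /leq_trans -> //; rewrite addnC.
apply: leq_trans (leq_add count_hit (leqnn _)); rewrite -count_predUI.
apply: leq_trans (leq_addr _ _); apply: sub_count => g /= /eqP ->.
by rewrite u1 mem_supportE u1 /=; case: (hit S g).
Qed.

End OrderCost.

(** * Many edge-disjoint gadgets in a dense graph *)

Lemma eq_set2 (T : finType) (a b c d : T) :
  ([set a; b] == [set c; d]) = ((a == c) && (b == d)) || ((a == d) && (b == c)).
Proof.
apply/eqP/orP => [/set2_eq[[-> ->]|[-> ->]]|]; rewrite ?eqxx; auto.
by case=> /andP[/eqP -> /eqP ->] //; rewrite setUC.
Qed.

Section GadgetExistence.
Variable V : finType.
Implicit Types (E : {set {set V}}) (ds : seq {set V}).

Lemma uniq_zigzag (g : gadget V) : uniq (center g :: hub g :: rim g) -> uniq (zigzag g).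
Proof.
case: g => [[u w] [[[a b] c] d]]; rewrite /center /hub /rim /=.
rewrite !inE !negb_or -!andbA !eq_set2.
rewrite ?[w == u]eq_sym ?[a == u]eq_sym ?[b == u]eq_sym ?[c == u]eq_sym ?[d == u]eq_sym.
rewrite ?[a == w]eq_sym ?[b == w]eq_sym ?[c == w]eq_sym ?[d == w]eq_sym.
rewrite ?[b == a]eq_sym ?[c == a]eq_sym ?[d == a]eq_sym ?[c == b]eq_sym ?[d == b]eq_sym.
rewrite ?[d == c]eq_sym ?eqxx.
by do 15![case/andP => /negbTE -> | move/negbTE => ->].
Qed.

Lemma zigzag_load (g : gadget V) v : uniq (center g :: hub g :: rim g) ->
  count (fun e : {set V} => v \in e) (zigzag g) <=
  4 * (v \in center g :: hub g :: rim g).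
Proof.
case: g => [[u w] [[[a b] c] d]]; rewrite /center /hub /rim /zigzag => gU.
have: count (mem [:: v]) [:: u; w; a; b; c; d] <= 1.
  rewrite (@eq_count _ _ (pred1 v)); last by move=> y; rewrite /= inE.
  by rewrite (count_uniq_mem v gU); case: (_ \in _).
rewrite /= !inE ![_ == v]eq_sym.
by do 6!case: (v == _).
Qed.

Definition used ds (v : V) : nat := count (fun e : {set V} => v \in e) ds.

Definition neighbors E (v : V) : {set V} := [set y | [set v; y] \in E].

Lemma card_neighbors E v : graphic E -> #|incident E v| <= #|neighbors E v|.
Proof.
move=> E2; apply: leq_trans (leq_imset_card (fun y => [set v; y]) (mem (neighbors E v))).
apply/subset_leq_card/subsetP=> e; rewrite inE => /andP[eE ve].
have [y _ eq_e] := edge_other E2 eE ve.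
by apply/imsetP; exists y; rewrite // inE -eq_e.
Qed.

Lemma card_used_neighbors ds v : #|[set y | [set v; y] \in ds]| <= used ds v.
Proof.
rewrite /used -size_filter cardE -(size_map (fun y => [set v; y])).
apply: uniq_leq_size.
  rewrite map_inj_uniq ?enum_uniq // => y z /set2_eq[[]|[-> ->]] //.
by move=> e /mapP[y + ->]; rewrite mem_enum inE mem_filter => ->; rewrite !inE eqxx.
Qed.

Lemma sum_used ds : {in ds, forall e : {set V}, #|e| = 2} -> \sum_v used ds v = 2 * size ds.
Proof.
move=> ds2; under eq_bigr => v _ do rewrite /used -sum1_count big_mkcond.
rewrite exchange_big /= (eq_big_seq (fun=> 2)).
  by rewrite big_const_seq count_predT iter_addn_0.
by move=> e /ds2 <-; rewrite -big_mkcond sum1_card.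
Qed.

(** Double counting.  The centre [u] has about [n / 8] neighbours that are not
    overloaded and are joined to it by unused edges, and each of those has about
    [n / 8] such neighbours, so some hub is joined to four of them when [n] is
    large. *)
Lemma find_gadget E ds u (L U K : nat) (hubs : seq V) :
    graphic E -> {in ds, forall e : {set V}, #|e| = 2} ->
    (forall v, #|V| <= 4 * #|incident E v|) ->
    used ds u <= U -> L <= U -> size hubs <= K ->
    16 * #|[set v | L < used ds v]| <= #|V| -> 16 * (U + K + 1) <= #|V| -> 192 < #|V| ->
  exists g, [/\ center g = u, uniq (center g :: hub g :: rim g),
    all (fun e => (e \in E) && (e \notin ds)) (zigzag g), hub g \notin hubs
    & all (fun v => used ds v <= L) (hub g :: rim g)].
Proof.
move=> E2 ds2 dense uU LU hK full nU n192; set n := #|V| in dense full nU n192.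
pose fresh v := [set y | [&& [set v; y] \in E, [set v; y] \notin ds & used ds y <= L]].
have fresh_card v : used ds v <= U -> n <= 4 * (#|fresh v| + U) + n %/ 4.
  move=> vU; have := dense v; have := card_neighbors v E2.
  have : #|neighbors E v| <= #|fresh v| + (#|[set y | [set v; y] \in ds]| + #|[set y | L < used ds y]|).
    apply: leq_trans (leq_add (leqnn _) (leq_card_setU _ _)).
    apply: leq_trans (leq_card_setU _ _); apply/subset_leq_card/subsetP=> y.
    by rewrite !inE => ->; case: (_ \in ds) => //=; rewrite leqNgt; case: (L < _).
  by have := card_used_neighbors ds v; lia.
pose W a := [set w in fresh a | (w != u) && (w \notin hubs)].
have W_big a : used ds a <= L -> n <= 8 * #|W a|.
  move=> aL; have aU := leq_trans aL LU; have := fresh_card a aU.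
  have : #|fresh a| <= #|W a| + (#|[set u]| + #|[set w in hubs]|).
    apply: leq_trans (leq_add (leqnn _) (leq_card_setU _ _)).
    apply: leq_trans (leq_card_setU _ _); apply/subset_leq_card/subsetP=> y.
    by rewrite !inE => ->; case: (y == u) => //=; case: (_ \in hubs).
  have : #|[set w in hubs]| <= K by rewrite cardsE; apply: leq_trans (card_size _) hK.
  by rewrite cards1; lia.
have N_big : n <= 8 * #|fresh u| by have := fresh_card u uU; lia.
have [w w4] : exists w, 3 < #|[set a in fresh u | w \in W a]|.
  have [/existsP //|/existsPn no] := boolP [exists w, 3 < #|[set a in fresh u | w \in W a]|].
  exfalso.
  have : \sum_(a in fresh u) #|W a| <= 3 * n.
    under eq_bigr => a _ do rewrite -sum1_card.
    rewrite (exchange_big_dep xpredT) //= mulnC -sum_nat_const; apply: leq_sum => w _.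
    have := no w; rewrite -leqNgt; apply: leq_trans; rewrite sum1dep_card.
    by apply/subset_leq_card/subsetP => a; rewrite !inE.
  have : \sum_(a in fresh u) n <= \sum_(a in fresh u) 8 * #|W a|.
    by apply: leq_sum => a; rewrite inE => /and3P[_ _ /W_big].
  rewrite sum_nat_const -big_distrr /=; move: (\sum_(a in _) _) N_big n192 => z; clear.
  by move: #|fresh u| => f; nia.
set A := [set a in fresh u | w \in W a] in w4.
have [a [b [c [d [abcd Asub]]]]] : exists a b c d, uniq [:: a; b; c; d] /\ {subset [:: a; b; c; d] <= A}.
  have := enum_uniq (mem A); have : {subset enum A <= A} by move=> y; rewrite mem_enum.
  rewrite cardE in w4; case: (enum A) w4 => [|a [|b [|c [|d l]]]] // _ lA lU.
  exists a, b, c, d; split.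
    by move: lU; rewrite -[_ :: _]/([:: a; b; c; d] ++ l) cat_uniq => /and3P[].
  by move=> y yl; apply: lA; rewrite -[_ :: _]/([:: a; b; c; d] ++ l) mem_cat yl.
have AP y : y \in A -> [/\ [&& [set u; y] \in E & [set u; y] \notin ds], used ds y <= L,
     [&& [set y; w] \in E & [set y; w] \notin ds], used ds w <= L & (w != u) && (w \notin hubs)].
  rewrite inE => /andP[]; rewrite inE => /and3P[-> -> ->]; rewrite !inE.
  by move=> /andP[/and3P[-> -> ->] ->].
have distinct y z : [set y; z] \in E -> y != z.
  by move/E2=> yz; apply/eqP=> E1; move: yz; rewrite E1 setUid cards1.
have fact y : y \in [:: a; b; c; d] -> _ := fun yl => AP y (Asub y yl).
have [/andP[uaE uaD] aL /andP[awE awD] wL /andP[wu wh]] := fact a (mem_head _ _).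
have [|/andP[ubE ubD] bL /andP[bwE bwD] _ _] := fact b; first by rewrite !inE eqxx ?orbT.
have [|/andP[ucE ucD] cL /andP[cwE cwD] _ _] := fact c; first by rewrite !inE eqxx ?orbT.
have [|/andP[udE udD] dL /andP[dwE dwD] _ _] := fact d; first by rewrite !inE eqxx ?orbT.
exists (u, w, (a, b, c, d)); split=> //.
- rewrite /center /hub /= in abcd *; rewrite abcd !inE !negb_or eq_sym wu.
  rewrite !(distinct u) // ![w == _]eq_sym !distinct //.
- by rewrite /= ![[set w; _]]setUC ![[set _; u]]setUC;
    rewrite uaE uaD ubE ubD ucE ucD udE udD awE awD bwE bwD cwE cwD dwE dwD.
- by rewrite /= wL aL bL cL dL.
Qed.

End GadgetExistence.

(** * The edge order *)

Section GoodOrder.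
Variable V : finType.
Implicit Types (E : {set {set V}}).

(** Gadgets are chosen greedily for the requested centres.  A vertex with more than
    [256 * K] used edges is not used as a hub or rim vertex again; counting used
    edges, at most [n / 16] vertices are ever excluded, and every vertex keeps
    bounded load. *)
Lemma gadget_system E (K : nat) (l : seq V) : graphic E ->
    (forall v, #|V| <= 4 * #|incident E v|) -> 16 * (261 * K + 5) <= #|V| -> 192 < #|V| ->
    (forall v, count_mem v l <= K) ->
  exists gs : seq (gadget V),
    [/\ map (@center V) gs = l,
        {in gs, forall g, uniq (center g :: hub g :: rim g)},
        uniq (flatten (map (@zigzag V) gs)),
        {subset flatten (map (@zigzag V) gs) <= E}
      & uniq [seq (center g, hub g) | g <- gs]].
Proof.
move=> E2 dense nK n192 lK; set n := #|V| in dense nK n192.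
suff [gs [H1 H2 H3 H4 [H5 _]]] : exists gs : seq (gadget V),
    [/\ map (@center V) gs = l,
        {in gs, forall g, uniq (center g :: hub g :: rim g)},
        uniq (flatten (map (@zigzag V) gs)),
        {subset flatten (map (@zigzag V) gs) <= E}
      & uniq [seq (center g, hub g) | g <- gs] /\
        forall v, used (flatten (map (@zigzag V) gs)) v <= 256 * K + 4 + 4 * count_mem v l].
  by exists gs.
elim: l lK => [|u l IHl] lK; first by exists [::].
have lK' v : count_mem v l <= K by apply: leq_trans (lK v); apply: leq_addl.
have [gs [gs_c gs_p gs_u gs_E [gs_h gs_l]]] := IHl lK'.
set ds := flatten _ in gs_u gs_E gs_l.
have ds2 : {in ds, forall e : {set V}, #|e| = 2} by move=> e /gs_E /E2.
have size_ds : size ds = 8 * size l.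
  rewrite -gs_c /ds; elim: (gs) => //= g s IHs; rewrite size_cat IHs.
  by case: g => [[u' w] [[[a b] c] d]] /=; lia.
have size_l : size l <= n * K.
  rewrite -sum1_size (sum_by_value id (fun=> 1)) -sum_nat_const.
  by apply: leq_sum => v _; rewrite mul1n; exact: lK'.
have full : 16 * #|[set v | 256 * K < used ds v]| <= n.
  have : #|[set v | 256 * K < used ds v]| * (256 * K).+1 <= \sum_v used ds v.
    rewrite -sum_nat_const big_mkcond /=; apply: leq_sum => v _; rewrite inE.
    by case: ifP.
  rewrite (sum_used ds2) size_ds; move: #|_| size_l => f; move: (size l) => z.
  have [->|K0] := posnP K; first by clear; lia.
  by clear -K0 => h1 h2; nia.
pose hubs := [seq hub g | g <- gs & center g == u].
have size_hubs : size hubs <= K.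
  rewrite size_map size_filter -(count_map (@center V) (pred1 u)) gs_c.
  exact: lK'.
have [] := @find_gadget V E ds u (256 * K) (260 * K + 4) K hubs E2 ds2 dense _ _ size_hubs full _ n192.
- by apply: leq_trans (gs_l u) _; have := lK' u; lia.
- by lia.
- by lia.
move=> g [gu gp gE gh gL].
have gE' : {subset zigzag g <= E} by move=> e /(allP gE)/andP[].
exists (g :: gs); split.
- by rewrite /= gu gs_c.
- by move=> h; rewrite inE => /predU1P[->|/gs_p].
- rewrite /= cat_uniq uniq_zigzag // gs_u andbT; apply/hasPn => e eds.
  by apply/negP => /(allP gE); rewrite eds andbF.
- by move=> e /=; rewrite mem_cat => /orP[/gE'|/gs_E].
split; first rewrite /= gs_h andbT.
  apply: contra gh => /mapP[h hgs [gch ->]]; apply/mapP; exists h => //.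
  by rewrite mem_filter -gch gu eqxx.
move=> v; have -> : used (flatten (map (@zigzag V) (g :: gs))) v = used (zigzag g) v + used ds v.
  exact: count_cat.
have : used (zigzag g) v <= 4 * (v \in center g :: hub g :: rim g) := zigzag_load v gp.
have := gs_l v; move: (used (zigzag g) v) => z /=.
have [_|uv] := eqVneq u v; first by case: (v \in _); lia.
rewrite inE gu [v == u]eq_sym (negbTE uv).
have [vg|_] := boolP (v \in hub g :: rim g); last by rewrite /=; lia.
by have /= := allP gL v vg; lia.
Qed.

Lemma edge_pairs (es : seq {set V}) : {in es, forall e : {set V}, #|e| = 2} ->
  exists s, map (@edge_of V) s = es.
Proof.
elim: es => [|e es IHes] H; first by exists [::].
have [|s sE] := IHes; first by move=> e' e'es; apply: H; rewrite inE e'es orbT.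
have /eqP/cards2P[a [b [_ eE]]] := H e (mem_head _ _).
by exists ((a, b) :: s); rewrite /= sE eE.
Qed.

(** The order lists [K] gadgets for each centre, and then the out-stars of a
    balanced orientation of the remaining edges.  All the segments are balanced up
    to a constant that depends on [m] only.  If the two sets differ, a vertex in
    just one of them is the centre of [K] gadgets, of which a bounded number are
    hit, and each of the others saves one run. *)
Lemma good_order E (K : nat) : graphic E ->
    (forall v, #|V| <= 4 * #|incident E v|) -> 16 * (261 * K + 5) <= #|V| -> 192 < #|V| ->
  exists2 ord : seq {set V}, uniq ord /\ ord =i E &
    forall (S : bool -> {set V}) (x : {set V} -> sign) (m : nat),
      (forall e b, x e = Some b -> ~~ [disjoint e & S b]) ->
      #|S true| <= m -> #|S false| <= m ->
      2 * runs None (map x ord) + (S true != S false) * (2 * K) <=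
      \sum_(e in E) weight S e + (6 * m + 152 * m ^ 2).
Proof.
move=> E2 dense nK n192.
pose l := flatten (nseq K (enum V)).
have lK v : count_mem v l = K.
  by rewrite /l count_flatten map_nseq sumn_nseq count_uniq_mem ?enum_uniq // mem_enum mul1n.
have [|gs [gs_c gs_p gs_u gs_E gs_h]] := @gadget_system E K l E2 dense nK n192.
  by move=> v; rewrite lK.
set ds := flatten _ in gs_u gs_E.
have [|s sE] := @edge_pairs [seq e <- enum E | e \notin ds].
  by move=> e; rewrite mem_filter mem_enum => /andP[_ /E2].
have [t [tE tB]] := balanced_orientation s.
have tu : uniq (map (@edge_of V) t).
  by rewrite (perm_uniq tE) sE filter_uniq ?enum_uniq.
have tl : {in t, forall p, p.1 != p.2}.
  move=> p pt; have : edge_of p \in map (@edge_of V) s by rewrite -(perm_mem tE) map_f.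
  rewrite sE mem_filter mem_enum => /andP[_ /E2]; rewrite /edge_of => p2.
  by apply/eqP=> pp; move: p2; rewrite pp setUid cards1.
have tS := perm_map (@edge_of V) (perm_stars t).
pose ord := ds ++ map (@edge_of V) (stars t).
have ordE : ord =i E.
  move=> e; rewrite mem_cat (perm_mem tS) (perm_mem tE) sE mem_filter mem_enum.
  by case: (boolP (e \in ds)) => [/gs_E|].
have ordu : uniq ord.
  rewrite cat_uniq gs_u (perm_uniq tS) tu andbT; apply/hasPn => e.
  by rewrite (perm_mem tS) (perm_mem tE) sE mem_filter => /andP[].
exists ord => // S x m xS mt mf.
have -> : \sum_(e in E) weight S e =
    \sum_(e <- ds) weight S e + \sum_(e <- map (@edge_of V) t) weight S e.
  rewrite -big_enum -(perm_big _ tS) -big_cat; apply: perm_big.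
  by apply: uniq_perm; rewrite ?enum_uniq // => e; rewrite mem_enum ordE.
have mU : #|S true :|: S false| <= 2 * m.
  by apply: leq_trans (leq_card_setU _ _) _; lia.
have rcat : runs None (map x ord) <= runs None (map x ds) + runs None [seq x (edge_of p) | p <- stars t].
  by rewrite map_cat -[X in _ ++ X]map_comp; exact: runs_cat.
have sc := stars_cost xS tu tl tB.
have gc := gadgets_cost xS gs_p.
have hc := count_hit S gs_u gs_h.
have kc : (S true != S false) * K <=
    count (fun g => (vweight S (center g) == 1) && ~~ hit S g) gs + 2 * #|S true :|: S false| ^ 2.
  case: eqP => [//|/eqP ST]; rewrite mul1n.
  have [u u1] : exists u, vweight S u = 1.
    have [/existsP[u /eqP u1]|/existsPn no] := boolP [exists u, vweight S u == 1].
      by exists u.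
    case/eqP: ST; apply/setP => v.
    by have := no v; rewrite /vweight; case: (v \in S true); case: (v \in S false).
  apply: (unhit_many gs_u gs_h u1); rewrite -(count_map (@center V) (pred1 u)) gs_c.
  by rewrite lK.
move: rcat sc gc hc kc; rewrite -/ds.
move: (runs _ _) (runs _ _) (runs _ _) (\sum_(e <- ds) _) (\sum_(e <- map _ _) _).
move: (count _ gs) (count _ gs) #|_ :|: _| mU => c1 c2 U mU r r1 r2 z1 z2.
have : U ^ 2 <= 4 * m ^ 2 by rewrite -[4]/(2 ^ 2) -expnMn leq_exp2r.
have -> : U * (3 + 2 * U) = 3 * U + 2 * U ^ 2 by rewrite -mulnn; lia.
by move: (U ^ 2) (m ^ 2) (_ != _) => U2 m2 b; clear -mU; lia.
Qed.

End GoodOrder.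

(** * Exact alternation number of the matching hypergraph *)

Lemma big_minn_le (I : finType) (P : pred I) (F : I -> nat) (N : nat) (i : I) :
  P i -> \big[minn/N]_(j | P j) F j <= F i.
Proof.
move=> Pi; have: i \in index_enum I by rewrite mem_index_enum.
elim: (index_enum I) => //= j s IHs; rewrite inE big_cons.
case/predU1P => [<-|/IHs H]; first by rewrite Pi geq_minl.
by case: ifP => // _; apply: leq_trans (geq_minr _ _) H.
Qed.

Lemma graphic_edges (G : sgraph) : graphic (edges G).
Proof.
move=> e; rewrite inE => /existsP[a /existsP[b /andP[ab /eqP->]]].
by rewrite cards2; case: eqP ab => // ->; rewrite adj_irr.
Qed.

Lemma degree_le_incident (G : sgraph) (v : G) : degree v <= #|incident (edges G) v|.
Proof.
rewrite /degree -(card_in_imset (f := fun y => [set v; y])); last first.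
  by move=> y z _ _ /set2_eq[[]|[-> ->]].
apply/subset_leq_card/subsetP => _ /imsetP[y + ->]; rewrite !inE eqxx andbT => vy.
by apply/existsP; exists v; apply/existsP; exists y; rewrite vy eqxx.
Qed.

Section EdgeOrder.
Variables (G : sgraph) (r : nat).
Hypothesis r2 : 2 <= r.
(* The slack [2 * K] equals the sum of the error terms [6 * r + 152 * r ^ 2] of
   [good_order] and [2 * r ^ 2] of [sum_weight_le]. *)
Let K := 77 * r ^ 2 + 3 * r.
Hypothesis dense : #|G| <= 4 * min_degree G.
Hypothesis big : 16 * (261 * K + 5) + 193 <= #|G|.
Local Notation E := (edges G).
Local Notation ex := (ex_matching G r).

Lemma dense_incident (v : G) : #|G| <= 4 * #|incident E v|.
Proof.
apply: leq_trans dense _; rewrite leq_mul2l /=; apply: leq_trans (degree_le_incident v).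
exact: big_minn_le.
Qed.

Lemma touching_le_ex (T : {set G}) : #|T| < r -> #|touching E T| <= ex.
Proof.
move=> Tr; apply: (leq_bigmax_cond (F := fun S : {set {set G}} => #|S|)).
rewrite touching_no_matching // eqxx andbT.
by apply/subsetP=> e; rewrite inE => /andP[].
Qed.

Lemma sum_weight_le (S : bool -> {set G}) : (forall b, #|S b| < r) ->
  \sum_(e in E) weight S e <=
  #|touching E (S true)| + #|touching E (S false)| + 2 * r ^ 2.
Proof.
move=> Sr; rewrite big_split /=.
have H b : \sum_(e in E) #|e :&: S b| <= #|touching E (S b)| + r ^ 2.
  apply: leq_trans (sum_card_touching _ (@graphic_edges G)) _.
  by rewrite leq_add2l leq_exp2r // ltnW.
apply: leq_trans (leq_add (H true) (H false)) _.
by rewrite mul2n -addnn addnACA.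
Qed.

(** Let [S b] be the set of heavy vertices of the class of sign [b].  If both sets
    have [r - 1] elements, then each class consists of edges meeting its set.  If
    moreover the sets are equal, already the number of signed edges is at most
    [ex]; if they differ, the slack of [good_order] absorbs all constants.  If one
    of the sets is smaller, adding a vertex to it shows that the edges meeting it
    are fewer than [ex] by about the minimum degree, which dominates all
    constants. *)
Lemma edge_order : exists2 ord : seq {set G}, uniq ord /\ ord =i E &
  forall x : {set G} -> sign,
    (forall b, matchings [set e in E | x e == Some b] r = set0) ->
    runs None (map x ord) <= ex.
Proof.
have [||ord [ordu ordE] ord_cost] := @good_order G E K (@graphic_edges G) dense_incident.
- by lia.
- by lia.
exists ord => // x x0.
pose P b := [set e in E | x e == Some b].
have PE b : P b \subset E by apply/subsetP=> e; rewrite inE => /andP[].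
have P2 b : graphic (P b) by move=> e /(subsetP (PE b)); exact: graphic_edges.
pose S b := heavy (P b) r.
have Sr b : #|S b| < r by apply: card_heavy (P2 b) (x0 b).
have sw := sum_weight_le Sr.
have tS b : #|touching E (S b)| <= ex by apply: touching_le_ex.
have touchE b : touching (P b) (S b) \subset touching E (S b).
  by apply/subsetP=> e; rewrite !inE => /andP[/andP[-> _] ->].
(* [y] erases the boundedly many edges that avoid the heavy vertices of their
   own sign class. *)
pose y e := if x e is Some b then if [disjoint e & S b] then None else Some b else None.
have yS e b : y e = Some b -> ~~ [disjoint e & S b].
  by rewrite /y; case: (x e) => [c|] //; case: ifP => // /negbT + [<-].
have cost := ord_cost S y r yS (ltnW (Sr true)) (ltnW (Sr false)).
have [/forallP Sall|/forallPn[b Sb]] := boolP [forall b, #|S b|.+1 == r].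
  have Pt b e : e \in P b -> e \in touching E (S b).
    move=> eP; apply: (subsetP (touchE b)).
    by rewrite (light_edges_empty (P2 b) (x0 b)) //; apply/eqP; exact: Sall.
  have xy : map x ord = map y ord.
    apply/eq_in_map => e; rewrite ordE /y => eE; case Ex: (x e) => [b|] //.
    have : e \in touching E (S b) by apply: Pt; rewrite inE eE Ex eqxx.
    by rewrite inE => /andP[_ /negbTE ->].
  have [ST|ST] := eqVneq (S true) (S false).
    apply: leq_trans (runs_le_count _ _) _.
    apply: leq_trans (tS true); rewrite count_map -size_filter cardE.
    apply: uniq_leq_size; first by rewrite filter_uniq.
    move=> e; rewrite mem_filter ordE mem_enum /= => /andP[xe eE].
    case Ex: (x e) xe => [b|] // _.
    have : e \in touching E (S b) by apply: Pt; rewrite inE eE Ex eqxx.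
    by case: (b); rewrite ?ST.
  move: cost; rewrite -xy ST mul1n /K; have := tS true; have := tS false.
  move: (runs _ _) sw; move: (\sum_(e in _) _) => z q; clear; lia.
have {}Sb : #|S b|.+1 < r by rewrite ltn_neqAle Sb Sr.
have [v vS] : exists v, v \notin S b.
  have : ~~ ([set: G] \subset S b).
    by apply/negP=> /subset_leq_card; rewrite cardsT; have := Sr b; lia.
  by case/subsetPn => v _ vS; exists v.
have := card_touchingU1 (@graphic_edges G) vS.
have : #|touching E (v |: S b)| <= ex.
  by apply: touching_le_ex; rewrite cardsU1 vS.
have := dense_incident v.
have yx e : y e != x e -> y e = None.
  by rewrite /y; case: (x e) => [c|] //; case: ifP => //; rewrite eqxx.
have := runs_erase ord yx.
have : count (fun e => y e != x e) ord <= 8 * r ^ 2.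
  pose bad b := P b :\: touching (P b) (S b).
  have badr b' : #|bad b'| <= 4 * r ^ 2 by apply: card_light_edges (P2 b') (x0 b').
  apply: (@leq_trans #|bad true :|: bad false|); last first.
    apply: leq_trans (leq_card_setU _ _) _.
    by have := badr true; have := badr false; lia.
  rewrite -size_filter cardE; apply: uniq_leq_size; first by rewrite filter_uniq.
  move=> e; rewrite mem_filter ordE mem_enum => /andP[yxe eE].
  suff [c ec] : exists c, e \in bad c by rewrite in_setU; case: c ec => ->; rewrite ?orbT.
  move: yxe; rewrite /y; case Ex: (x e) => [c|]; last by rewrite eqxx.
  case: ifP => [ec _|]; last by rewrite eqxx.
  by exists c; rewrite in_setD [e \in touching _ _]inE ec andbF inE eE Ex eqxx.
move: (Sr b) (tS (~~ b)) big; rewrite /K.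
have : #|touching E (S true)| + #|touching E (S false)| =
   #|touching E (S b)| + #|touching E (S (~~ b))| by case: (b); rewrite // addnC.
move: sw cost; move: (\sum_(e in _) _) (count _ _) (runs _ _) (runs _ _) => z1 z2 z3 z4.
move: #|touching E (S true)| #|touching E (S false)| #|touching E (S b)| #|touching E (S (~~ b))|.
move: #|touching E (v |: S b)| #|incident E v| #|S b| #|G| ex (r ^ 2) (_ != _).
clear; lia.
Qed.

End EdgeOrder.

(** The hypergraph has all sets of vertices of [G] as ground set.  Those that are
    not edges lie in no hyperedge; placed first in the order, each adds at most
    one to the alternation number, which the larger ground set compensates. *)
Section MatchingHypergraph.
Variables (G : sgraph) (r : nat).
Hypothesis r2 : 2 <= r.

Lemma matchings_neq0 : set0 \notin matchings (edges G) r.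
Proof. by rewrite inE cards0 eq_sym (gtn_eqF (ltnW r2)) andbF. Qed.

Definition matching_hypergraph : hypergraph := Hypergraph matchings_neq0.

Lemma alt_matching_hypergraph (ord : seq {set G}) :
    uniq ord -> ord =i edges G ->
    (forall x : {set G} -> sign,
       (forall b, matchings [set e in edges G | x e == Some b] r = set0) ->
       runs None (map x ord) <= ex_matching G r) ->
  alt matching_hypergraph + #|edges G| <= #|{set G}| + ex_matching G r.
Proof.
move=> ordu ordE ord_ex; pose s := enum (~: edges G) ++ ord.
have su : uniq s.
  rewrite cat_uniq enum_uniq ordu andbT; apply/hasPn => e.
  by rewrite ordE mem_enum in_setC negbK.
have sN : size s == #|hvert matching_hypergraph|.
  rewrite -(card_uniqP su); apply/eqP/eq_card => e.
  by rewrite mem_cat mem_enum ordE in_setC orNb.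
apply: (@leq_trans (alt_ord (Tuple sN) + #|edges G|)).
  by rewrite leq_add2r; apply: big_minn_le.
have C : #|edges G| + #|~: edges G| = #|{set G}| := cardsC _.
suff: alt_ord (Tuple sN) <= #|~: edges G| + ex_matching G r by move: C; lia.
apply/bigmax_leqP=> X /andP[Xt Xf]; rewrite alt_seqE.
pose x e := nth None X (index e s).
have Xx : X = map x s :> seq sign.
  have sX : size X = size s by rewrite size_tuple; exact/esym/eqP.
  apply: (@eq_from_nth _ None) => [|i]; rewrite sX ?size_map // => iN.
  by rewrite (nth_map set0) // /x index_uniq.
rewrite Xx map_cat; apply: leq_trans (runs_cat _ _) _; apply: leq_add.
  by apply: leq_trans (runs_le_count _ _) _; rewrite (leq_trans (count_size _ _)) // size_map -cardE.
apply: ord_ex => b; apply/setP=> M; rewrite [RHS]inE; apply/negP => Mb.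
have: contains_hedge (sign_part (Tuple sN) X b).
  apply/existsP; exists M; apply/andP; split.
    apply: (subsetP (matchings_sub r _) M Mb).
    by apply/subsetP=> e; rewrite inE => /andP[].
  move: Mb; rewrite inE => /and3P[/subsetP MP _ _]; apply/subsetP=> e /MP.
  rewrite inE => /andP[eE /eqP xe]; apply/imsetP.
  have es : index e s < #|hvert matching_hypergraph|.
    by move: (eqP sN) => <-; rewrite index_mem mem_cat ordE eE orbT.
  exists (Ordinal es).
    by rewrite inE (tnth_nth None) /= -/(x e) xe.
  by rewrite (tnth_nth set0) /= nth_index // mem_cat ordE eE orbT.
by case: b {Mb}; rewrite ?(negbTE Xt) ?(negbTE Xf).
Qed.

End MatchingHypergraph.

Theorem altermatic_KG_matching (G : sgraph) (r : nat) : 2 <= r ->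
    #|G| <= 4 * min_degree G -> 16 * (261 * (77 * r ^ 2 + 3 * r) + 5) + 193 <= #|G| ->
  is_altermatic (KG_matching G r) (#|edges G| - ex_matching G r) /\
  chi (KG_matching G r) = #|edges G| - ex_matching G r.
Proof.
move=> r2 dense big.
have [ord [ordu ordE] ord_ex] := edge_order r2 dense big.
have lo := alt_matching_hypergraph r2 ordu ordE ord_ex.
have mid := altermatic_le_chi (matching_hypergraph G r2).
have up := chi_KG_matching_le G (ltnW r2).
have chiE : chi (KG (matching_hypergraph G r2)) = chi (KG_matching G r) by [].
have altE : #|hvert (matching_hypergraph G r2)| = #|{set G}| by [].
have val : chi (KG_matching G r) = #|edges G| - ex_matching G r by lia.
split=> //; split.
  exists (matching_hypergraph G r2); last by lia.
  by split; exists id.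
move=> H [HG _]; rewrite -val; apply: leq_trans (altermatic_le_chi H) _.
exact: chi_hom HG.
Qed.

Import Order.TTheory GRing.Theory Num.Theory.
Local Open Scope ring_scope.

Theorem theorem3 (R : realType) (r : nat) (hr : (2 <= r)%N) :
  exists (alpha beta : R) (n0 : nat), 0 < alpha /\
    forall (G : sgraph) (n : nat), #|G| = n ->
      (2^-1 - alpha) * n%:R + beta <= (min_degree G)%:R -> (n0 <= n)%N ->
      exists2 zeta : nat, is_altermatic (KG_matching G r) zeta &
        chi (KG_matching G r) = zeta /\
        zeta = (#|edges G| - ex_matching G r)%N.
Proof.
exists 4^-1, 0, (16 * (261 * (77 * r ^ 2 + 3 * r) + 5) + 193)%N.
split=> [|G n nE dense big]; first by rewrite invr_gt0 ltr0n.
have dense4 : (#|G| <= 4 * min_degree G)%N.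
  rewrite nE -(ler_nat R) natrM mulrC -ler_pdivrMr ?ltr0n //.
  apply: le_trans dense; rewrite addr0 mulrC ler_wpM2r ?ler0n //.
  by lra.
rewrite -nE in big.
have [alt_eq chi_eq] := altermatic_KG_matching hr dense4 big.
by exists (#|edges G| - ex_matching G r)%N.
Qed.
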